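(* Let $t\ge 2$ be an even integer. If $G$ is a planar graph of maximum degree $d\ge 4$ and girth at least $6(t^2+t-2)$, then $\chi_t(G)\le \tau_t(d)$, where $\tau_t(d)=\frac{1}{d-2}\big(d(d-1)^{t/2}-2\big)$.
   Context: Graphs are simple. The distance between two vertices is the number of edges of a shortest path joining them. The distance-$t$ chromatic number $\chi_t(G)$ is the least number of colours in a colouring of $V(G)$ in which any two distinct vertices at distance at most $t$ receive different colours. The girth is the length of a shortest cycle (infinite for forests). *)

(* Defs.v *)
From mathcomp Require Import all_boot all_order all_algebra.
From mathcomp Require Import all_classical all_reals all_analysis.

Set Implicit Arguments.
Unset Strict Implicit.
Unset Printing Implicit Defensive.

Import Order.TTheory GRing.Theory Num.Theory numFieldNormedType.Exports.

Local Open Scope classical_set_scope.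
Local Open Scope ring_scope.

Record sgraph := SGraph {
  svertex :> finType;
  sedge : rel svertex;
  sedge_sym : symmetric sedge;
  sedge_irrefl : irreflexive sedge
}.

Notation "x -- y" := (sedge x y) (at level 30).

(* Minimum of a set of natural numbers, [None] standing for +oo (the minimum
   of the empty set). *)
Definition least (P : nat -> Prop) : option nat :=
  if pselect (exists n, `[< P n >]) is left exP then Some (ex_minn exP)
  else None.

Definition at_most (m : option nat) (n : nat) : bool :=
  if m is Some k then (k <= n)%N else false.

Definition at_least (m : option nat) (n : nat) : bool :=
  if m is Some k then (n <= k)%N else true.

Section GraphParameters.
Variable G : sgraph.

Definition degree (x : G) : nat := #|[pred y | x -- y]|.

Definition max_degree : nat := \max_(x : G) degree x.

(* The path [x :: p] has [size p] edges. *)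
Definition dist (x y : G) : option nat :=
  least (fun n => exists p : seq G,
    [/\ path (@sedge G) x p, uniq (x :: p), last x p = y & size p = n]).

(* [ucycle] also accepts [:: x; y] for an edge [x -- y], whence the bound. *)
Definition girth : option nat :=
  least (fun n => exists c : seq G,
    [/\ ucycle (@sedge G) c, (2 < size c)%N & size c = n]).

Definition dist_colorable (t k : nat) : bool :=
  [exists f : {ffun G -> 'I_k}, forall x : G, forall y : G,
    (x != y) && at_most (dist x y) t ==> (f x != f y)].

Lemma dist_colorable_ex (t : nat) : exists k, dist_colorable t k.
Proof.
exists #|G|; apply/existsP; exists [ffun x => enum_rank x].
apply/forallP => x; apply/forallP => y; apply/implyP => /andP[xy _].
by rewrite !ffunE (inj_eq enum_rank_inj).
Qed.

Definition dist_chromatic (t : nat) : nat := ex_minn (dist_colorable_ex t).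

End GraphParameters.

Section Planarity.
Variable R : realType.

Definition is_arc (A : set (R * R)) (p q : R * R) : Prop :=
  exists f : R -> R * R,
    [/\ {within `[0, 1], continuous f}, {in `[0, 1] &, injective f},
        f 0 = p, f 1 = q & A = f @` `[0, 1]].

(* The curve of the edge [x -- y] is [E [set x; y]]; the values of [E] on
   vertex sets that are not edges are irrelevant. *)
Definition plane_drawing (G : sgraph) (pos : G -> R * R)
    (E : {set G} -> set (R * R)) : Prop :=
  [/\ injective pos,
      forall x y : G, x -- y -> is_arc (E [set x; y]%SET) (pos x) (pos y),
      forall x y z : G, x -- y -> E [set x; y]%SET (pos z) -> z = x \/ z = y
    & forall x y u v : G, x -- y -> u -- v ->
        [set x; y]%SET <> [set u; v]%SET ->
        E [set x; y]%SET `&` E [set u; v]%SET `<=` range pos].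

Definition planar (G : sgraph) : Prop :=
  exists pos E, @plane_drawing G pos E.

End Planarity.

Definition tau (t d : nat) : rat :=
  (d%:R - 2)^-1 * (d%:R * (d%:R - 1) ^+ (t %/ 2) - 2).

(* Main.v *)
Require Import Defs.
From mathcomp Require Import all_boot all_order all_algebra.
From mathcomp Require Import all_classical all_reals all_analysis.
From mathcomp Require Import fintype finset zify lra.

(* Sparsity. A plane drawing is approximated in a fine grid: boxes around the
   vertices, joined along grid walks close to the arcs, exhibit the graph as a
   minor of a grid. The grid has a Whitney dual, and having one is inherited by
   minors; since the face boundaries span the cycle space and every edge lies on
   at most two of them, Euler's inequality (m - n + 1) g <= 2 m follows for a
   graph of girth g. Hence a 2-core of girth at least 12 t contains a thread
   v_0, ..., v_(2t+1) whose interior vertices have degree 2 in the core. Note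
   that 6 (t^2 + t - 2) >= 12 t.

   Colouring. Put t = 2 k, so that tau t d is the size of a ball of radius k in
   the d-regular tree. Forests are coloured greedily by depth, because all the
   earlier vertices within distance t of x lie in the k-ball around the k-th
   ancestor of x. Otherwise delete the middle edge of a thread, colour the rest by
   induction, and keep the colours of the vertices at distance at most k from
   the outside of the thread. The remaining vertices, on the thread and in the
   trees hanging from it, are recoloured greedily by distance from v_0, vertices
   closer to the spine first; for such a vertex the precoloured vertices at the
   far end that can conflict are fewer than the vertices of the k-ball
   around its k-th ancestor that are still uncoloured. *)

Set Implicit Arguments.
Unset Strict Implicit.
Unset Printing Implicit Defensive.

Import Order.TTheory GRing.Theory Num.Theory.

(** * Whitney duals and Euler's inequality *)

Section CycleSpace.
Local Open Scope ring_scope.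

(** No face of the drawing is ever formed. The arcs are merely continuous, so planarity is moved to
    a grid, where faces are pairs of indices and the parity of ray crossings shows directly that
    their boundaries span the cycle space. Only this algebraic property passes to minors, and a rank
    computation replaces the counting of faces. The thread has [4 * k + 1] edges so that its middle
    edge has [2 * k] edges on either side: a path through that edge between two vertices that keep
    their colours has at least [k + 1 + k] edges, too many to create a conflict. The greedy count
    has no slack: [tau t d] is exactly the bound for a ball, so each conflicting precoloured vertex
    at the far end must be paid for by an uncoloured place in the ball. Let [a = d - 1] and let [x]
    hang at height [h < k] over the spine. The order of recolouring frees about [a ^ k - a ^ h]
    places on the outermost level, while the far end contributes at most twice the sum of [a ^ i]
    for [h <= i < k]. *)

Lemma addF2 (x : 'F_2) : x + x = 0.
Proof. by apply: addrr_pchar2; apply: pchar_Fp. Qed.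

(** The cycle space over ['F_2], an edge being represented by its two darts, which carry the same
    value. *)
Definition cycle_vec (X : finType) (e : rel X) (k : X -> X -> 'F_2) : Prop :=
  [/\ forall p q, k p q = k q p,
      forall p q, ~~ e p q -> k p q = 0
    & forall p, \sum_q k p q = 0].

(* Whitney's abstract dual: [a] and [b] are the two faces along an edge. *)
Definition has_dual (X : finType) (e : rel X) : Prop :=
  exists (L : Type) (a b : X -> X -> L),
    [/\ forall p q, a p q = a q p,
        forall p q, b p q = b q p,
        forall h : L -> 'F_2,
          cycle_vec e (fun p q => if e p q then h (a p q) + h (b p q) else 0)
      & forall k, cycle_vec e k ->
          exists h : L -> 'F_2, forall p q, e p q -> k p q = h (a p q) + h (b p q)].

(** Each unordered pair is counted twice. Hence, when degrees are summed over a branch set, only the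
    edges leaving it remain. *)
Lemma sum_sym_F2 (X : finType) (A : {pred X}) (k : X -> X -> 'F_2) :
  (forall p q, k p q = k q p) -> (forall p, k p p = 0) ->
  \sum_(p in A) \sum_(q in A) k p q = 0.
Proof.
move=> ks k0.
pose S (r : rel X) := \sum_(p in A) \sum_(q in A | r p q) k p q.
pose lt (p q : X) := (enum_rank p < enum_rank q)%N.
have -> : \sum_(p in A) \sum_(q in A) k p q = S lt + S (fun p q => lt q p).
  rewrite /S -big_split /=; apply: eq_bigr => p _.
  rewrite (bigID (lt p)) /=; congr (_ + _).
  rewrite (bigID (fun q => lt q p)) /= [X in _ + X]big1 ?addr0.
    apply: eq_bigl => q; rewrite /lt -andbA; congr (_ && _).
    by case: ltngtP.
  move=> q /andP[/andP[_ h1] h2]; suff -> : p = q by [].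
  by apply/enum_rank_inj/val_inj; move: h1 h2; rewrite /lt; case: ltngtP.
suff -> : S (fun p q => lt q p) = S lt by exact: addF2.
rewrite /S; under eq_bigr do rewrite big_mkcondr /=.
under [RHS]eq_bigr do rewrite big_mkcondr /=.
rewrite exchange_big /=; apply: eq_bigr => p _; apply: eq_bigr => q _.
by rewrite ks.
Qed.

Lemma connect_tjoin (X : finType) (e : rel X) (A : {pred X}) (p b : X) :
  symmetric e -> irreflexive e ->
  connect (fun p q => [&& e p q, p \in A & q \in A]) p b ->
  exists w : X -> X -> 'F_2,
    [/\ forall q r, w q r = w r q,
        forall q r, ~~ [&& e q r, q \in A & r \in A] -> w q r = 0
      & forall q, \sum_r w q r = (q == p)%:R + (q == b)%:R].
Proof.
move=> es ei /connectP[s]; elim: s p => [|c s IH] p /= => [_ ->|/andP[/and3P[epc pA cA] hs] hb].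
  by exists (fun _ _ => 0); split=> // q; rewrite big1 // addF2.
have [w [ws w0 wd]] := IH _ hs hb.
have npc : p != c by apply: contraTneq epc => ->; rewrite ei.
exists (fun q r => w q r + (((q == p) && (r == c))%:R + ((q == c) && (r == p))%:R)).
split=> [q r|q r nqr|q].
- by rewrite ws; congr (_ + _); rewrite addrC andbC [(q == p) && _]andbC.
- have -> : (q == p) && (r == c) = false.
    by apply: contraNF nqr => /andP[/eqP-> /eqP->]; rewrite epc pA.
  have -> : (q == c) && (r == p) = false.
    by apply: contraNF nqr => /andP[/eqP-> /eqP->]; rewrite es epc pA cA.
  by rewrite w0 // !addr0.
- rewrite !big_split /= wd.
  have E (u v : X) : \sum_r ((q == u) && (r == v))%:R = (q == u)%:R :> 'F_2.
    case: (q == u) => /=; last by rewrite big1.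
    by rewrite (bigD1 v) //= eqxx big1 ?addr0 // => i /negPf ->.
  by rewrite !E addrC -addrA (addrA (q == c)%:R) addF2 add0r.
Qed.

(** A T-join inside a connected set: every vertex is joined to one base vertex [b], with weight [t],
    and the contributions at [b] cancel because [t] sums to zero. It closes up cycles of a minor
    inside the branch sets. *)
Lemma tjoin (X : finType) (e : rel X) (A : {pred X}) (t : X -> 'F_2) :
  symmetric e -> irreflexive e ->
  {in A &, forall p q, connect (fun p q => [&& e p q, p \in A & q \in A]) p q} ->
  (forall p, p \notin A -> t p = 0) -> \sum_p t p = 0 ->
  exists w : X -> X -> 'F_2,
    [/\ forall q r, w q r = w r q,
        forall q r, ~~ [&& e q r, q \in A & r \in A] -> w q r = 0
      & forall q, \sum_r w q r = t q].
Proof.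
move=> es ei conA t0 st; have [b bA|A0] := pickP (mem A); last first.
  exists (fun _ _ => 0); split=> // q; rewrite big1 // t0 //.
  by apply/negP => qA; have := A0 q; rewrite /= qA.
have : forall p, exists w : X -> X -> 'F_2, p \in A ->
    [/\ forall q r, w q r = w r q,
        forall q r, ~~ [&& e q r, q \in A & r \in A] -> w q r = 0
      & forall q, \sum_r w q r = (q == p)%:R + (q == b)%:R].
  move=> p; case: (boolP (p \in A)) => pA; last by exists (fun _ _ => 0).
  by have [w hw] := connect_tjoin es ei (conA p b pA bA); exists w.
move=> /choice[W hW].
exists (fun q r => \sum_(p in A) t p * W p q r); split=> [q r|q r nqr|q].
- by apply: eq_bigr => p /hW[-> _ _].
- by apply: big1 => p /hW[_ -> //]; rewrite mulr0.
- rewrite exchange_big /=.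
  rewrite (eq_bigr (fun p => t p * (q == p)%:R + t p * (q == b)%:R)); last first.
    by move=> p /hW[_ _ hp]; rewrite -mulr_sumr hp mulrDr.
  rewrite big_split /= -mulr_suml.
  have -> : \sum_(i in A) t i = 0.
    by rewrite -[RHS]st [RHS](bigID (mem A)) /= [X in _ = _ + X]big1 ?addr0 // => p /t0.
  rewrite mul0r addr0 (bigID (pred1 q)) /= [X in _ + X]big1 ?addr0; last first.
    by move=> p /andP[_ /negPf]; rewrite eq_sym => ->; rewrite mulr0.
  case: (boolP (q \in A)) => qA.
    by rewrite (big_pred1 q) ?eqxx ?mulr1 // => p /=; case: eqP => [->|]; rewrite ?qA ?andbF.
  by rewrite big1 ?t0 // => p /andP[pA /eqP pq]; rewrite -pq pA in qA.
Qed.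

End CycleSpace.

(** * Duals of minors *)

Section Minor.
Local Open Scope ring_scope.

(* A minor model: [mu] sends a vertex of the host graph to the branch set
   containing it. Contracting the branch sets and deleting the other edges of
   the host restricts its dual to one edge per edge of the minor, with the two
   faces along each deleted edge merged. *)
Lemma minor_dual (X Y : finType) (e : rel X) (e' : rel Y) (mu : X -> option Y) :
  symmetric e -> irreflexive e -> symmetric e' -> irreflexive e' ->
  (forall p q x, mu p = Some x -> mu q = Some x ->
     connect (fun p q => [&& e p q, mu p == Some x & mu q == Some x]) p q) ->
  (forall x y, e' x y -> exists p q, [/\ e p q, mu p = Some x & mu q = Some y]) ->
  has_dual e -> has_dual e'.
Proof.
move=> es ei es' ei' con edg [L [a [b [asym bsym dfrom dto]]]].
have [p0 _|X0] := pickP (mem [set: X]); last first.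
  have e'0 x y : e' x y = false.
    by apply/negP => /edg[p _]; have := X0 p; rewrite /= inE.
  exists unit, (fun _ _ => tt), (fun _ _ => tt); split=> // [h|k _].
    by split=> [p q|p q _|p]; rewrite ?e'0 // big1 // => q _; rewrite e'0.
  by exists (fun _ => 0) => p q; rewrite e'0.
have : forall xy : Y * Y, exists pq : X * X, e' xy.1 xy.2 ->
    [/\ e pq.1 pq.2, mu pq.1 = Some xy.1 & mu pq.2 = Some xy.2].
  move=> [x y]; case: (boolP (e' x y)) => [/[dup] exy /edg[p [q h]]|nexy].
    by exists (p, q).
  by exists (p0, p0).
move=> /choice[kap0 kap0P].
pose swap (pq : X * X) := (pq.2, pq.1).
(* One host edge is chosen per edge of the minor; ordering by rank makes the two orientations choose
   the same host edge. *)
pose kap x y := if (enum_rank x < enum_rank y)%N then kap0 (x, y) else swap (kap0 (y, x)).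
have kapP x y : e' x y -> [/\ e (kap x y).1 (kap x y).2, mu (kap x y).1 = Some x &
    mu (kap x y).2 = Some y].
  rewrite /kap; case: ifP => _ exy; first exact: kap0P.
  by have [|h1 h2 h3] := kap0P (y, x); [rewrite es' | rewrite /swap /=; split=> //; rewrite es].
have kapS x y : e' x y -> kap y x = swap (kap x y).
  move=> exy; have nxy : x != y by apply: contraTneq exy => ->; rewrite ei'.
  rewrite /kap; case: (ltngtP (enum_rank x) (enum_rank y)) => // [_|/val_inj/enum_rank_inj h].
    by rewrite /swap; case: (kap0 _).
  by rewrite h eqxx in nxy.
pose ch p q := if (mu p, mu q) is (Some x, Some y) then e' x y && (kap x y == (p, q)) else false.
have chP p q x y : mu p = Some x -> mu q = Some y -> ch p q = e' x y && (kap x y == (p, q)).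
  by rewrite /ch => -> ->.
(* Chosen edges and edges inside a branch set are kept, all others are deleted; [compat] asks a
   labelling of the faces to agree across every deleted edge. *)
pose kept p q := ch p q || (mu p == mu q) && (mu p != None).
pose compat (h : L -> 'F_2) := forall p q, e p q -> ~~ kept p q -> h (a p q) = h (b p q).
(* A merged face is represented by evaluation at it on the compatible labellings, so faces on both
   sides of a deleted edge become equal without forming a quotient. *)
pose L' : Type := {h | compat h} -> 'F_2.
pose lab (l : L) : L' := fun hh => sval hh l.
pose a' x y := lab (a (kap x y).1 (kap x y).2).
pose b' x y := lab (b (kap x y).1 (kap x y).2).
have a's x y : e' x y -> a' y x = a' x y.
  by move=> exy; rewrite /a' kapS //= asym.
have b's x y : e' x y -> b' y x = b' x y.
  by move=> exy; rewrite /b' kapS //= bsym.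
(* Symmetry is required of all pairs, but [kap] is known to be symmetric on edges only; hence the
   constant default. *)
pose a'' x y := if e' x y then a' x y else (fun _ => 0).
pose b'' x y := if e' x y then b' x y else (fun _ => 0).
exists L', a'', b''; split.
- by move=> x y; rewrite /a'' (es' y x); case: ifP => // exy; rewrite (a's x y).
- by move=> x y; rewrite /b'' (es' y x); case: ifP => // exy; rewrite (b's x y).
- move=> h'; pose hh l := h' (lab l).
  have hhc : compat hh.
    move=> p q epq nk; rewrite /hh; congr (h' _); apply: functional_extensionality_dep => -[g gc].
    exact: gc.
  pose k p q := if e p q then hh (a p q) + hh (b p q) else 0.
  have [ks k0 kd] : cycle_vec e k := dfrom hh.
  have kapk x y : e' x y -> (if e' x y then h' (a'' x y) + h' (b'' x y) else 0) =
      k (kap x y).1 (kap x y).2.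
    by move=> exy; have [h _ _] := kapP _ _ exy; rewrite /k /a'' /b'' exy h.
  split=> [x y|x y /negPf -> //|x].
    rewrite /a'' /b'' (es' y x); case: ifP => // exy; by rewrite exy (a's x y) // (b's x y).
  (* The degree of [x] in the minor is the sum of the host degrees over its branch set, since inner
     edges cancel and deleted ones carry zero. *)
  transitivity (\sum_(p | mu p == Some x) \sum_q k p q); last by apply: big1 => p _; exact: kd.
  rewrite [RHS](eq_bigr (fun p => \sum_(q | mu q == Some x) k p q +
                             \sum_(q | mu q != Some x) k p q)); last first.
    by move=> p _; rewrite (bigID (fun q => mu q == Some x)).
  have kpp p : k p p = 0 by rewrite /k ei.
  have in0 : \sum_(p | mu p == Some x) \sum_(q | mu q == Some x) k p q = 0.
    exact: (@sum_sym_F2 X (fun p => mu p == Some x) k ks kpp).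
  rewrite [RHS]big_split /= in0 add0r.
  rewrite [LHS](eq_bigr (fun y => \sum_(p | mu p == Some x) \sum_(q | mu q != Some x)
     (if e' x y && (kap x y == (p, q)) then k p q else 0))); last first.
    move=> y _; case: (boolP (e' x y)) => [exy|nexy]; last by rewrite big1 // => p _; rewrite big1.
    have [h1 h2 h3] := kapP _ _ exy.
    have := kapk _ _ exy; rewrite exy => ->.
    rewrite (bigD1 (kap x y).1) ?h2 //= [X in _ + X]big1 ?addr0; last first.
      move=> p /andP[_ /negPf np]; rewrite big1 // => q _.
      by case: eqP => // kpq; rewrite kpq /= eqxx in np.
    have nyx : Some y != Some x.
      by apply: contraTneq exy => -[->]; rewrite ei'.
    rewrite (bigD1 (kap x y).2) ?h3 //= -surjective_pairing eqxx [X in _ + X]big1 ?addr0 //.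
    move=> q /andP[_ /negPf np]; case: eqP => // kpq; by rewrite kpq /= eqxx in np.
  rewrite exchange_big /=; apply: eq_bigr => p /eqP mp.
  rewrite exchange_big /=; apply: eq_bigr => q mq.
  case mqE : (mu q) => [y|]; last first.
    rewrite big1 => [|y _].
      rewrite /k; case: ifP => // epq; have := hhc p q epq.
      rewrite /kept /ch mp mqE /= => ->; first by rewrite addF2.
      by [].
    by case: ifP => // /andP[exy /eqP kpq]; have [_ _] := kapP _ _ exy; rewrite kpq /= mqE.
  rewrite (bigD1 y) //= [X in _ + X]big1 ?addr0 => [|z nz].
    case: ifP => // nch; rewrite /k; case: ifP => // epq; have := hhc p q epq.
    rewrite /kept (chP _ _ _ _ mp mqE) nch /= mp eq_sym (negPf mq) => -> //.
    by rewrite addF2.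
  case: ifP => // /andP[exy /eqP kpq]; have [_ _] := kapP _ _ exy; rewrite kpq /= mqE => -[yz].
  by rewrite yz eqxx in nz.
- move=> z [zs z0 zd].
  pose k0 p q := if (mu p, mu q) is (Some x, Some y) then
     (if e' x y && (kap x y == (p, q)) then z x y else 0) else 0.
  have k0s p q : k0 p q = k0 q p.
    rewrite /k0; case: (mu p) => [x|]; case: (mu q) => [y|] //.
    rewrite es'; case exy : (e' y x) => //=; rewrite (kapS y x exy) zs.
    by rewrite /swap; case: (kap y x) => u v /=; rewrite !xpair_eqE andbC.
  (* [k0] lifts the cycle to the chosen host edges and [t] is its degree defect. The defect sums to
     zero on each branch set, where a T-join repairs it. *)
  pose t p := \sum_q k0 p q.
  have tsum x : \sum_(p | mu p == Some x) t p = 0.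
    rewrite -[RHS](zd x) /t.
    transitivity (\sum_y \sum_(p | mu p == Some x) \sum_q
       (if e' x y && (kap x y == (p, q)) then z x y else 0)).
      rewrite [RHS]exchange_big /=; apply: eq_bigr => p /eqP mp.
      rewrite [RHS]exchange_big /=; apply: eq_bigr => q _.
      rewrite /k0 mp; case mqE : (mu q) => [y|].
        rewrite (bigD1 y) //= [X in _ + X]big1 ?addr0 // => y' ny.
        case: ifP => // /andP[exy /eqP kpq]; have [_ _] := kapP _ _ exy.
        by rewrite kpq /= mqE => -[yy]; rewrite yy eqxx in ny.
      rewrite big1 // => y _; case: ifP => // /andP[exy /eqP kpq].
      by have [_ _] := kapP _ _ exy; rewrite kpq /= mqE.
    apply: eq_bigr => y _; case: (boolP (e' x y)) => [exy|nexy]; last first.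
      by rewrite z0 // big1 // => p _; rewrite big1.
    have [h1 h2 h3] := kapP _ _ exy.
    rewrite (bigD1 (kap x y).1) ?h2 //= [X in _ + X]big1 ?addr0; last first.
      move=> p /andP[_ /negPf np]; rewrite big1 // => q _.
      by case: eqP => // kpq; rewrite kpq /= eqxx in np.
    rewrite (bigD1 (kap x y).2) //= -surjective_pairing eqxx [X in _ + X]big1 ?addr0 //.
    move=> q /negPf np; case: eqP => // kpq; by rewrite kpq /= eqxx in np.
  have : forall x, exists w : X -> X -> 'F_2,
    [/\ forall q r, w q r = w r q,
        forall q r, ~~ [&& e q r, mu q == Some x & mu r == Some x] -> w q r = 0
      & forall q, \sum_r w q r = if mu q == Some x then t q else 0].
    move=> x; apply: (tjoin (A := fun p => mu p == Some x)) => //.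
    - by move=> p q /eqP hp /eqP hq; apply: con.
    - by move=> p; rewrite unfold_in => /negPf ->.
    - by rewrite -big_mkcond tsum.
  move=> /choice[w hw].
  pose k p q := k0 p q + \sum_x w x p q.
  have ek0 p q : ~~ e p q -> k0 p q = 0.
    rewrite /k0; case: (mu p) => [x|]; case: (mu q) => [y|] // nepq.
    case: ifP => // /andP[exy /eqP kpq]; have [+ _ _] := kapP _ _ exy.
    by rewrite kpq /= (negPf nepq).
  have [] := dto k.
    split=> [p q|p q nepq|p].
    - by rewrite /k k0s; congr (_ + _); apply: eq_bigr => x _; have [-> _ _] := hw x.
    - rewrite /k ek0 // big1 ?addr0 // => x _; have [_ -> //] := hw x.
      by rewrite (negPf nepq).
    - rewrite big_split /= exchange_big /= -/(t p).
      rewrite (eq_bigr (fun x => if mu p == Some x then t p else 0)); last first.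
        by move=> x _; have [_ _ ->] := hw x.
      case mpE : (mu p) => [x|].
        rewrite (bigD1 x) //= eqxx [X in _ + (_ + X)]big1 ?addr0 ?addF2 // => y ny.
        by case: eqP => // -[xy]; rewrite xy eqxx in ny.
      rewrite big1 // addr0 /t big1 // => q _; by rewrite /k0 mpE.
  move=> h hk.
  have w0 p q x : mu p != mu q -> w x p q = 0.
    move=> npq; have [_ -> //] := hw x; apply: contra npq => /and3P[_ /eqP -> /eqP ->]; exact: eqxx.
  (* The lifted cycle vanishes on deleted edges, so the labelling that represents it agrees across
     them. *)
  have hc : compat h.
    move=> p q epq; rewrite /kept negb_or => /andP[nch nmu].
    suff : h (a p q) + h (b p q) = 0.
      by move=> s0; rewrite -[LHS]addr0 -(addF2 (h (b p q))) addrA s0 add0r.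
    rewrite -hk // /k big1 ?addr0 => [|x _].
      move: nch; rewrite /k0 /ch; case: (mu p) => [x|]; case: (mu q) => [y|] //.
      by move=> /negPf ->.
    have [mpq|/w0 -> //] := eqVneq (mu p) (mu q).
    have [_ -> //] := hw x; rewrite epq /= mpq andbb; apply: contra nmu => /eqP mq.
    by rewrite mpq mq eqxx.
  exists (fun phi => phi (exist _ h hc)) => x y exy.
  rewrite /a'' /b'' exy /a' /b' /lab /=; have [h1 h2 h3] := kapP _ _ exy.
  rewrite -hk // /k big1 ?addr0 => [|u _].
    by rewrite /k0 h2 h3 exy -surjective_pairing eqxx.
  apply: w0; rewrite h2 h3; apply: contraTneq exy => -[->]; by rewrite ei'.
Qed.

End Minor.

(** * The square grid and its faces *)

Section Grid.
Local Open Scope ring_scope.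
Variable N : nat.
Notation point := ('I_N * 'I_N)%type.

Definition grid_adj (p q : point) : bool :=
  (p.1 == q.1 :> nat) && ((p.2.+1 == q.2 :> nat) || (q.2.+1 == p.2 :> nat)) ||
  (p.2 == q.2 :> nat) && ((p.1.+1 == q.1 :> nat) || (q.1.+1 == p.1 :> nat)).

Lemma grid_adj_sym : symmetric grid_adj.
Proof.
move=> p q; rewrite /grid_adj [(q.1 == p.1 :> nat)]eq_sym [(q.2 == p.2 :> nat)]eq_sym.
by rewrite [(q.2.+1 == _ :> nat) || _]orbC [(q.1.+1 == _ :> nat) || _]orbC.
Qed.

Lemma grid_adj_irrefl : irreflexive grid_adj.
Proof. by move=> p; rewrite /grid_adj !eqxx !gtn_eqF. Qed.

Section Sums.
Variable k : point -> point -> 'F_2.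
Hypothesis ks : forall p q, k p q = k q p.
Hypothesis k0 : forall p q, ~~ grid_adj p q -> k p q = 0.

Let isr (i j : nat) (p q : point) :=
  [&& p.1 == i :> nat, p.2 == j :> nat, q.1 == i.+1 :> nat & q.2 == j :> nat].
Let isu (i j : nat) (p q : point) :=
  [&& p.1 == i :> nat, p.2 == j :> nat, q.1 == i :> nat & q.2 == j.+1 :> nat].
(** Value of [k] on the edge from [(i, j)] to [(i.+1, j)]. As a sum over all pairs it makes sense
    for all natural indices and is zero outside the grid. *)
Let rgt i j := \sum_p \sum_q (if isr i j p q then k p q else 0).
Let upw i j := \sum_p \sum_q (if isu i j p q then k p q else 0).
Let lft i j := if i is i'.+1 then rgt i' j else 0.
Let dwn i j := if j is j'.+1 then upw i j' else 0.

Let point_eq (p q : point) : p.1 = q.1 :> nat -> p.2 = q.2 :> nat -> p = q.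
Proof. by case: p q => [p1 p2] [q1 q2] /= /val_inj -> /val_inj ->. Qed.

Let rgtE (p : point) : rgt p.1 p.2 = \sum_q (if isr p.1 p.2 p q then k p q else 0).
Proof.
rewrite /rgt (bigD1 p) //= [X in _ + X]big1 ?addr0 // => p' np.
apply: big1 => q _; case: ifP => // /and4P[/eqP h1 /eqP h2 _ _].
by rewrite (point_eq h1 h2) eqxx in np.
Qed.

Let upwE (p : point) : upw p.1 p.2 = \sum_q (if isu p.1 p.2 p q then k p q else 0).
Proof.
rewrite /upw (bigD1 p) //= [X in _ + X]big1 ?addr0 // => p' np.
apply: big1 => q _; case: ifP => // /and4P[/eqP h1 /eqP h2 _ _].
by rewrite (point_eq h1 h2) eqxx in np.
Qed.

Let lftE (p : point) : lft p.1 p.2 =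
  \sum_(q : point) (if (q.1.+1 == p.1 :> nat) && (q.2 == p.2 :> nat) then k p q else 0).
Proof.
rewrite /lft; case pE : (nat_of_ord p.1) => [|i]; first by rewrite big1.
rewrite /rgt; apply: eq_bigr => q _.
rewrite (bigD1 p) //= [X in _ + X]big1 ?addr0 => [|p' np].
  by rewrite /isr pE !eqxx !andbT eqSS ks.
case: ifP => // /and4P[_ _ /eqP h1 /eqP h2].
by rewrite (point_eq (p := p') (q := p)) ?pE // eqxx in np.
Qed.

Let dwnE (p : point) : dwn p.1 p.2 =
  \sum_(q : point) (if (q.1 == p.1 :> nat) && (q.2.+1 == p.2 :> nat) then k p q else 0).
Proof.
rewrite /dwn; case pE : (nat_of_ord p.2) => [|j]; first by rewrite big1 // => q; rewrite andbF.
rewrite /upw; apply: eq_bigr => q _.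
rewrite (bigD1 p) //= [X in _ + X]big1 ?addr0 => [|p' np].
  by rewrite /isu pE !eqxx !andbT eqSS ks.
case: ifP => // /and4P[_ _ /eqP h1 /eqP h2].
by rewrite (point_eq (p := p') (q := p)) ?pE // eqxx in np.
Qed.

Let grid_sumE (p : point) :
  \sum_q k p q = rgt p.1 p.2 + lft p.1 p.2 + (upw p.1 p.2 + dwn p.1 p.2).
Proof.
rewrite rgtE lftE upwE dwnE -!big_split /=; apply: eq_bigr => q _.
rewrite /isr /isu !eqxx /=.
have [adj|/[dup] nadj /k0 ->] := boolP (grid_adj p q).
  have : [\/ [&& q.1 == p.1.+1 :> nat & q.2 == p.2 :> nat],
     [&& q.1.+1 == p.1 :> nat & q.2 == p.2 :> nat],
     [&& q.1 == p.1 :> nat & q.2 == p.2.+1 :> nat] |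
     [&& q.1 == p.1 :> nat & q.2.+1 == p.2 :> nat] ].
    case/orP: adj => /andP[/eqP -> /orP[]/eqP <-]; rewrite !eqxx.
    - by apply: Or43.
    - by apply: Or44.
    - by apply: Or41.
    - by apply: Or42.
  case=> /andP[/eqP h1 /eqP h2].
  - by rewrite ifT ?ifF ?addr0 //; lia.
  - by rewrite ifF; [rewrite ifT ?ifF ?addr0 ?add0r //; lia|lia].
  - by rewrite ifF; [rewrite ifF; [rewrite ifT ?ifF ?addr0 ?add0r //; lia|lia]|lia].
  - by rewrite ifF; [rewrite ifF; [rewrite ifF; [rewrite ifT ?addr0 ?add0r //; lia|lia]|lia]|lia].
by rewrite !if_same !addr0.
Qed.

Let rgt_edge (p q : point) :
  q.1 = p.1.+1 :> nat -> q.2 = p.2 :> nat -> rgt p.1 p.2 = k p q.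
Proof.
move=> h1 h2; rewrite rgtE (bigD1 q) //= [X in _ + X]big1 ?addr0 => [|q' nq].
  by rewrite /isr h1 h2 !eqxx.
case: ifP => // /and4P[_ _ /eqP h3 /eqP h4].
by rewrite (point_eq (p := q') (q := q)) ?h1 ?h2 // eqxx in nq.
Qed.

Let upw_edge (p q : point) :
  q.1 = p.1 :> nat -> q.2 = p.2.+1 :> nat -> upw p.1 p.2 = k p q.
Proof.
move=> h1 h2; rewrite upwE (bigD1 q) //= [X in _ + X]big1 ?addr0 => [|q' nq].
  by rewrite /isu h1 h2 !eqxx.
case: ifP => // /and4P[_ _ /eqP h3 /eqP h4].
by rewrite (point_eq (p := q') (q := q)) ?h1 ?h2 // eqxx in nq.
Qed.

Let rgt_out i j : (N <= i.+1)%N || (N <= j)%N -> rgt i j = 0.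
Proof.
move=> h; apply: big1 => p _; apply: big1 => q _; case: ifP => // /and4P[_ _ /eqP h1 /eqP h2].
by move: h; rewrite -h1 -h2 => /orP[]; rewrite leqNgt ltn_ord.
Qed.

Let upw_out i j : (N <= i)%N || (N <= j.+1)%N -> upw i j = 0.
Proof.
move=> h; apply: big1 => p _; apply: big1 => q _; case: ifP => // /and4P[_ _ /eqP h1 /eqP h2].
by move: h; rewrite -h1 -h2 => /orP[]; rewrite leqNgt ltn_ord.
Qed.

(* [h (i, j)] is the parity of the crossings of [k] with the upward vertical ray
   issued from the face with upper right corner [(i, j)]. *)
Lemma grid_ray : (forall p, \sum_q k p q = 0) ->
  exists h : nat * nat -> 'F_2,
    [/\ forall i j, ~~ [&& (0 < i)%N, (i < N)%N, (0 < j)%N & (j < N)%N] -> h (i, j) = 0,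
        forall p q : point, q.1 = p.1.+1 :> nat -> q.2 = p.2 :> nat ->
          k p q = h (p.1.+1, p.2.+1) + h (p.1.+1, p.2 : nat)
      & forall p q : point, q.1 = p.1 :> nat -> q.2 = p.2.+1 :> nat ->
          k p q = h (p.1.+1, p.2.+1) + h (p.1 : nat, p.2.+1)].
Proof.
move=> kd.
pose h (c : nat * nat) := if c.1 is i.+1 then \sum_(c.2 <= l < N) rgt i l else 0.
(* Adding up the degree conditions of column [i] from height [j] upwards, the vertical edges
   telescope and only the lowest one is left. *)
have step i j : (j <= N)%N -> h (i.+1, j) + h (i, j) = dwn i j.
  move=> jN; have [iN|Ni] := ltnP i N; last first.
    rewrite /h /= big1 => [|l _]; last by rewrite rgt_out // leqW.
    rewrite add0r /dwn; case: i Ni => [|i] Ni.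
      by case: j jN => // j jN; rewrite upw_out // Ni.
    rewrite big1 => [|l _]; last by rewrite rgt_out // Ni.
    by case: j jN => // j jN; rewrite upw_out // Ni.
  have -> : h (i.+1, j) + h (i, j) = \sum_(j <= l < N) (rgt i l + lft i l).
    rewrite big_split /= /h /lft /=; case: i {iN} => [|i] //.
    by rewrite [X in _ = _ + X]big1.
  have E l : (l < N)%N -> rgt i l + lft i l = upw i l + dwn i l.
    move=> lN; have := kd (Ordinal iN, Ordinal lN); rewrite grid_sumE /= => s0.
    by rewrite -[LHS]addr0 -(addF2 (upw i l + dwn i l)) addrA s0 add0r.
  rewrite (eq_big_nat _ _ (F2 := fun l => upw i l + dwn i l)); last first.
    by move=> l /andP[_ /E].
  have oppF2 (x : 'F_2) : - x = x by apply/eqP; rewrite eq_sym -addr_eq0 addF2.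
  rewrite (eq_bigr (fun l => dwn i l.+1 - dwn i l)) => [|l _]; last by rewrite oppF2.
  rewrite telescope_sumr // oppF2 /dwn; case: (N) upw_out => [|n] out.
    by rewrite add0r.
  by rewrite out ?add0r // leqnn orbT.
have h0 i : h (i, 0%N) = 0.
  by elim: i => [//|i IH]; have := step i 0%N isT; rewrite IH addr0.
exists h; split.
- move=> [|i] j; first by [].
  case: j => [|j]; first by rewrite h0.
  rewrite !ltn0Sn /= negb_and -!leqNgt => /orP[Ni|Nj]; rewrite /h /=.
    by rewrite big1 // => l _; rewrite rgt_out ?Ni.
  by rewrite big_geq.
- by move=> p q h1 h2; rewrite -(rgt_edge h1 h2) /h /= [X in _ + X]big_ltn // addrCA addF2 addr0.
- by move=> p q h1 h2; rewrite -(upw_edge h1 h2) step.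
Qed.

(** Each of the four faces around a grid point borders two of the four edges there. Since all faces
    outside the grid share the value [o], a missing border edge also satisfies the formula, with
    value zero. *)
Lemma grid_faces_sum (c : nat * nat -> 'F_2) (o : 'F_2) :
  (forall i j, ~~ [&& (0 < i)%N, (i < N)%N, (0 < j)%N & (j < N)%N] -> c (i, j) = o) ->
  (forall p q : point, q.1 = p.1.+1 :> nat -> q.2 = p.2 :> nat ->
     k p q = c (p.1.+1, p.2.+1) + c (p.1.+1, p.2 : nat)) ->
  (forall p q : point, q.1 = p.1 :> nat -> q.2 = p.2.+1 :> nat ->
     k p q = c (p.1.+1, p.2.+1) + c (p.1 : nat, p.2.+1)) ->
  forall p, \sum_q k p q = 0.
Proof.
move=> cout cr cu p; rewrite grid_sumE.
have rE i j : (j < N)%N -> rgt i j = c (i.+1, j.+1) + c (i.+1, j).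
  move=> jN; have [iN|Ni] := ltnP i.+1 N.
    pose p1 : point := (Ordinal (ltnW iN), Ordinal jN).
    pose q1 : point := (Ordinal iN, Ordinal jN).
    by rewrite (@rgt_edge p1 q1) // (@cr p1 q1).
  by rewrite rgt_out ?Ni // !cout ?addF2 //= ltnNge Ni.
have uE i j : (i < N)%N -> upw i j = c (i.+1, j.+1) + c (i, j.+1).
  move=> iN; have [jN|Nj] := ltnP j.+1 N.
    pose p1 : point := (Ordinal iN, Ordinal (ltnW jN)).
    pose q1 : point := (Ordinal iN, Ordinal jN).
    by rewrite (@upw_edge p1 q1) // (@cu p1 q1).
  by rewrite upw_out ?Nj ?orbT // !cout ?addF2 //= [(j.+1 < N)%N]ltnNge Nj ?andbF.
have lE : lft p.1 p.2 = c (p.1 : nat, p.2.+1) + c (p.1 : nat, p.2 : nat).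
  by rewrite /lft; case: (nat_of_ord p.1) => [|i]; rewrite ?rE // !cout // addF2.
have dE : dwn p.1 p.2 = c (p.1.+1, p.2 : nat) + c (p.1 : nat, p.2 : nat).
  by rewrite /dwn; case: (nat_of_ord p.2) => [|j]; rewrite ?uE // !cout ?addF2 ?andbF.
rewrite rE // lE uE // dE.
set x := c _; set y := c _; set z := c _; set w := c _.
rewrite [X in X + _](_ : _ = (x + y) + (z + w)) //.
rewrite [X in _ + X](_ : _ = (x + y) + (z + w)) ?addF2 //.
by rewrite !addrA; congr (_ + _); rewrite -!addrA; congr (_ + _); rewrite addrC.
Qed.

End Sums.

(** A face is named by its upper right corner; all corners that name no bounded face collapse to
    [(0, 0)], the unbounded one. Below, [fa] is the face above a horizontal or right of a vertical
    edge, and [fb] the opposite one. *)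
Let norm (c : nat * nat) :=
  if [&& (0 < c.1)%N, (c.1 < N)%N, (0 < c.2)%N & (c.2 < N)%N] then c else (0%N, 0%N).
Let fa (p q : point) := norm ((minn p.1 q.1).+1, (minn p.2 q.2).+1).
Let fb (p q : point) :=
  if p.1 == q.1 :> nat then norm (minn p.1 q.1, (minn p.2 q.2).+1)
  else norm ((minn p.1 q.1).+1, minn p.2 q.2).

Lemma grid_dual : has_dual grid_adj.
Proof.
have fas p q : fa p q = fa q p by rewrite /fa minnC [minn p.2 _]minnC.
have fbs p q : fb p q = fb q p by rewrite /fb minnC [minn p.2 _]minnC eq_sym.
exists (nat * nat)%type, fa, fb; split=> //.
- move=> h; pose k (p q : point) : 'F_2 := if grid_adj p q then h (fa p q) + h (fb p q) else 0.
  change (cycle_vec grid_adj k).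
  have ks p q : k p q = k q p.
    by rewrite /k grid_adj_sym (fas p) (fbs p).
  have k0 p q : ~~ grid_adj p q -> k p q = 0 by rewrite /k => /negPf ->.
  have nout i j : ~~ [&& (0 < i)%N, (i < N)%N, (0 < j)%N & (j < N)%N] ->
      h (norm (i, j)) = h (0%N, 0%N).
    by rewrite /norm => /negPf /= ->.
  split=> //; apply: (@grid_faces_sum k ks k0 (h \o norm) _ nout) => p q h1 h2.
    have -> : k p q = h (fa p q) + h (fb p q) by rewrite /k /grid_adj h1 h2 !eqxx orbT.
    by rewrite /fa /fb h1 h2 ltn_eqF // minnn (minn_idPl _).
  have -> : k p q = h (fa p q) + h (fb p q) by rewrite /k /grid_adj h1 h2 !eqxx.
  by rewrite /fa /fb h1 h2 eqxx minnn (minn_idPl _).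
- move=> k [ks k0 kd]; have [h [hout hr hu]] := grid_ray ks k0 kd.
  have hn c : h (norm c) = h c.
    rewrite /norm; case: ifP => // /negbT; case: c => i j /= out.
    by rewrite hout // hout.
  exists h.
  have main (p q : point) : (q.1 = p.1.+1 :> nat /\ q.2 = p.2 :> nat) \/
      (q.1 = p.1 :> nat /\ q.2 = p.2.+1 :> nat) -> k p q = h (fa p q) + h (fb p q).
    case=> -[h1 h2].
      by rewrite /fa /fb !hn (hr p q) // h1 h2 ltn_eqF // minnn (minn_idPl _) // !hn.
    by rewrite /fa /fb !hn (hu p q) // h1 h2 eqxx minnn (minn_idPl _) // !hn.
  move=> p q /orP[] /andP[/eqP h1 /orP[]/eqP h2].
  - by apply: main; right.
  - rewrite ks main; last by right.
    by rewrite fas fbs.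
  - by apply: main; left.
  - rewrite ks main; last by left.
    by rewrite fas fbs.
Qed.

End Grid.

(** * Euler's inequality by ranks *)

Section Euler.
Local Open Scope ring_scope.

(* With [m] edges and connected support, [m + 1 - #|C|] is the dimension of the
   cycle space. It is spanned by the boundaries of the faces, so at least that
   many of these are nonzero; each edge lies on at most two of them. *)
Lemma dual_euler (Y : finType) (e : rel Y) (C : {set Y}) (g : nat) :
  symmetric e -> irreflexive e -> has_dual e ->
  (forall x y, e x y -> x \in C) -> C != set0 ->
  (forall k, cycle_vec e k -> (exists p q, k p q != 0) ->
     (2 * g <= #|[set u : Y * Y | (k u.1 u.2 != 0)%R]|)%N) ->
  ((#|[set u : Y * Y | e u.1 u.2]| + 2 - 2 * #|C|) * g <=
    2 * #|[set u : Y * Y | e u.1 u.2]|)%N.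
Proof.
move=> es ei [L [a [b [asym bsym dfrom dto]]]] eC /set0Pn[c0 c0C] hg.
set darts := [set u : Y * Y | e u.1 u.2].
pose fwd (u : Y * Y) := (enum_rank u.1 < enum_rank u.2)%N.
pose Ed := [set u in darts | fwd u].
pose swap (u : Y * Y) := (u.2, u.1).
have swapK : involutive swap by case.
have dartsE : #|darts| = (2 * #|Ed|)%N.
  rewrite -(cardsID Ed darts) mul2n -addnn; congr (_ + _)%N.
    by congr #|pred_of_set _|; apply/setP => u; rewrite !inE; case: (e _ _).
  rewrite -(card_imset _ (inv_inj swapK)); congr #|pred_of_set _|; apply/setP => u.
  have memI (v : Y * Y) (A : {set Y * Y}) : (v \in swap @: A) = (swap v \in A).
    by rewrite -{1}(swapK v) (mem_imset _ _ (inv_inj swapK)).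
  rewrite memI !inE /swap /fwd /= [e u.2 u.1]es; case eu : (e u.1 u.2) => //=; rewrite ?andbF //.
  case: ltngtP => // /val_inj/enum_rank_inj h; by rewrite h ei in eu.
pose m := #|Ed|; pose ev (i : 'I_m) : Y * Y := enum_val i.
have evE (i : 'I_m) : e (ev i).1 (ev i).2 /\ fwd (ev i).
  by have := enum_valP i; rewrite !inE => /andP[].
pose inc (i : 'I_m) (y : Y) : 'F_2 := ((ev i).1 == y)%:R + ((ev i).2 == y)%:R.
pose A : 'M['F_2]_(m, #|Y|) := \matrix_(i, v) inc i (enum_val v).
(* Every row of the incidence matrix [A] sums to zero, so the column of [c0] is determined by the
   others: [A] factors through the columns of [C :\ c0]. *)
have rkA : (\rank A <= #|C|.-1)%N.
  have cD : #|C :\ c0| = #|C|.-1 by rewrite (cardsD1 c0 C) c0C.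
  pose B : 'M['F_2]_(m, #|C :\ c0|) := \matrix_(i, r) inc i (enum_val r).
  pose K : 'M['F_2]_(#|C :\ c0|, #|Y|) :=
    \matrix_(r, v) ((enum_val r == enum_val v)%:R + (enum_val v == c0)%:R).
  have -> : A = B *m K.
    apply/matrixP => i v; rewrite !mxE; set y := enum_val v.
    rewrite (eq_bigr (fun r => inc i (enum_val r) * ((enum_val r == y)%:R + (y == c0)%:R))); last first.
      by move=> r _; rewrite !mxE.
    rewrite -(big_enum_val (fun z => inc i z * ((z == y)%:R + (y == c0)%:R))) /=.
    have sC w : w \in C -> \sum_(z in C :\ c0) (w == z)%:R = (w != c0)%:R :> 'F_2.
      move=> wC; have [->|nw] /= := eqVneq w c0.
        by apply: big1 => z; rewrite !inE eq_sym => /andP[/negPf ->].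
      rewrite (bigD1 w) ?inE ?nw //= eqxx big1 ?addr0 // => z /andP[_ /negPf].
      by rewrite eq_sym => ->.
    have [eE _] := evE i; have e1C := eC _ _ eE.
    have e2C : (ev i).2 \in C by apply: (eC _ (ev i).1); rewrite es.
    have [yc|yc] /= := eqVneq y c0.
      rewrite (eq_bigr (fun z => ((ev i).1 == z)%:R + ((ev i).2 == z)%:R)); last first.
        by move=> z; rewrite !inE yc => /andP[/negPf -> _]; rewrite add0r mulr1.
      rewrite big_split /= !sC // /inc yc.
      by case: eqP; case: eqP => _ _; rewrite /= ?addF2 ?addr0 ?add0r.
    have [yC|nyC] := boolP (y \in C).
      rewrite (bigD1 y) ?inE ?yc //= eqxx addr0 mulr1 big1 ?addr0 // => z /andP[_ /negPf ->].
      by rewrite addr0 mulr0.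
    rewrite big1 => [|z]; last first.
      rewrite !inE => /andP[_ zC]; have [zy|_] := eqVneq z y; last by rewrite addr0 mulr0.
      by rewrite -zy zC in nyC.
    rewrite /inc; do 2![case: eqP => [h|_]; first by rewrite -h ?e1C ?e2C in nyC].
    by rewrite addr0.
  by rewrite -cD (leq_trans (mxrankM_maxl _ _)) // rank_leq_col.
pose lab (s : (Y * Y) * bool) : L := if s.2 then b s.1.1 s.1.2 else a s.1.1 s.1.2.
(* Faces are labels in an arbitrary type; each is counted through one chosen pair and side that
   bears it. *)
pose rp (s : (Y * Y) * bool) := odflt s [pick s' | `[< lab s' = lab s >]].
have rpE s s' : lab s = lab s' -> rp s = rp s'.
  move=> h; rewrite /rp h; case: pickP => // /(_ s'); by rewrite asboolT.
have rpP s : lab (rp s) = lab s.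
  by rewrite /rp; case: pickP => [s' /asboolP|].
pose hs s (l : L) : 'F_2 := (`[< exists s', lab s' = l /\ rp s' = s >])%:R.
have hsE s s' : hs s (lab s') = (rp s' == s)%:R.
  rewrite /hs; congr (nat_of_bool _)%:R; apply/asboolP/eqP => [[s2 [h <-]]|h].
    exact: rpE.
  by exists s'.
pose ks s p q : 'F_2 := if e p q then hs s (a p q) + hs s (b p q) else 0.
have ksC s : cycle_vec e (ks s) := dfrom (hs s).
have ksE s p q : e p q -> ks s p q = (rp (p, q, false) == s)%:R + (rp (p, q, true) == s)%:R.
  by move=> epq; rewrite /ks epq -!hsE.
pose S0 := [set s | [exists u : Y * Y, ks s u.1 u.2 != 0]].
(* Double counting: a nonzero boundary has at least [2 * g] darts, and a dart lies on the boundary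
   of at most its own two faces. *)
have countS0 : (#|S0| * (2 * g) <= 2 * #|darts|)%N.
  apply: (@leq_trans (\sum_(s in S0) #|[set u : Y * Y | (ks s u.1 u.2 != 0)%R]|)%N).
    rewrite -sum_nat_const; apply: leq_sum => s; rewrite inE => /existsP[u hu].
    by apply: hg => //; exists u.1, u.2.
  under eq_bigr do rewrite -sum1_card big_mkcond /=.
  rewrite exchange_big /= mulnC -sum_nat_const [X in (_ <= X)%N]big_mkcond /=.
  apply: leq_sum => u _; rewrite inE; case: ifP => eu; last first.
    rewrite big1 // => s _; by rewrite inE /ks eu eqxx.
  rewrite (@leq_trans (\sum_s ((rp (u.1, u.2, false) == s) + (rp (u.1, u.2, true) == s)))%N) //.
    rewrite big_mkcond /=; apply: leq_sum => s _; rewrite [u \in _]inE ksE //.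
    case: (s \in S0) => //; case: (rp _ == s); case: (rp _ == s) => //=; rewrite ?addr0 ?eqxx //.
  have one v : (\sum_s nat_of_bool (v == s) = 1)%N.
    by rewrite (bigD1 v) //= eqxx big1 ?addn0 // => s /negPf; rewrite eq_sym => ->.
  by rewrite big_split /= !one.
(* A vector killed by [A] is a cycle vector, and the labelling given by duality writes it as a
   combination of face boundaries, of which those outside [S0] vanish. *)
have rkK : (\rank (kermx A) <= #|S0|)%N.
  pose M : 'M['F_2]_(#|S0|, m) := \matrix_(r, i) ks (enum_val r) (ev i).1 (ev i).2.
  suff kM : (kermx A <= M)%MS by apply: leq_trans (mxrankS kM) (rank_leq_row _).
  apply/row_subP => j; have : (row j (kermx A) <= kermx A)%MS by exact: row_sub.
  move: (row j _) => u /sub_kermxP uA.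
  pose z x y := \sum_i u 0 i * ((ev i == (x, y))%:R + (ev i == (y, x))%:R).
  have zC : cycle_vec e z.
    split=> [p q|p q nepq|p].
    - by apply: eq_bigr => i _; rewrite addrC.
    - apply: big1 => i _; have [eE _] := evE i.
      case: eqP => [h|_]; first by rewrite h /= (negPf nepq) in eE.
      case: eqP => [h|_]; first by rewrite h /= es (negPf nepq) in eE.
      by rewrite addr0 mulr0.
    - rewrite exchange_big /=.
      have uA0 : (u *m A) 0 (enum_rank p) = 0 by rewrite uA mxE.
      rewrite -[RHS]uA0 mxE.
      apply: eq_bigr => i _; rewrite !mxE enum_rankK -mulr_sumr big_split /=; congr (_ * (_ + _)).
        case evi : (ev i) => [x y] /=; have [->|nx] := eqVneq x p.
          rewrite (bigD1 y) //= eqxx big1 ?addr0 // => q /negPf nq.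
          by rewrite xpair_eqE [y == q]eq_sym nq andbF.
        by apply: big1 => q _; rewrite xpair_eqE (negPf nx).
      case evi : (ev i) => [x y] /=; have [->|ny] := eqVneq y p.
        rewrite (bigD1 x) //= eqxx big1 ?addr0 // => q /negPf nq.
        by rewrite xpair_eqE [x == q]eq_sym nq.
      by apply: big1 => q _; rewrite xpair_eqE (negPf ny) andbF.
  have zE i : z (ev i).1 (ev i).2 = u 0 i.
    rewrite /z (bigD1 i) //= -surjective_pairing eqxx [X in _ + X]big1 ?addr0 => [|i' ni].
      have [eE] := evE i; case: (ev i) eE => x y /= exy _.
      by rewrite xpair_eqE; have [xy|] := eqVneq x y; rewrite ?addr0 ?mulr1 //; rewrite xy ei in exy.
    rewrite (inj_eq enum_val_inj) (negPf ni) add0r.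
    case: eqP => [h|_]; last by rewrite mulr0.
    have [_] := evE i'; have [_] := evE i; rewrite /fwd h /= => h1 h2.
    by have := ltn_trans h1 h2; rewrite ltnn.
  have [h hz] := dto z zC.
  apply/submxP; exists (\row_r h (lab (enum_val r))); apply/rowP => i; rewrite !mxE.
  rewrite (eq_bigr (fun r => h (lab (enum_val r)) * ks (enum_val r) (ev i).1 (ev i).2)); last first.
    by move=> r _; rewrite !mxE.
  rewrite -(big_enum_val (fun s => h (lab s) * ks s (ev i).1 (ev i).2)) /=.
  rewrite -zE; have [eE _] := evE i; rewrite hz //.
  transitivity (\sum_s h (lab s) * ks s (ev i).1 (ev i).2); last first.
    rewrite [LHS](bigID (mem S0)) /= [X in _ + X]big1 ?addr0 // => s.
    rewrite inE negb_exists => /forallP /(_ (ev i)); rewrite negbK => /eqP ->.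
    by rewrite mulr0.
  under eq_bigr do rewrite ksE // mulrDr.
  rewrite big_split /=.
  have pick1 v : \sum_s h (lab s) * (rp v == s)%:R = h (lab v).
    rewrite (bigD1 (rp v)) //= eqxx mulr1 rpP big1 ?addr0 // => s /negPf.
    by rewrite eq_sym => ->; rewrite mulr0.
  by rewrite !pick1.
have : (m - #|C|.-1 <= #|S0|)%N.
  by apply: leq_trans rkK; rewrite mxrank_ker leq_sub2l.
have Cpos : (0 < #|C|)%N by apply/card_gt0P; exists c0.
rewrite dartsE in countS0 *; move: countS0 Cpos.
rewrite /m; move: #|S0| #|C| #|Ed| => s c m'; nia.
Qed.

End Euler.

(** * From plane drawings to grid minors *)

Section Curves.
Local Open Scope classical_set_scope.
Local Open Scope ring_scope.
Variable R : realType.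
Import numFieldNormedType.Exports.

Definition eps_cont (f : R -> R) : Prop :=
  forall s e, 0 < e -> exists2 d, 0 < d & forall s', `|s' - s| < d -> `|f s' - f s| < e.

(** Compactness of the unit segment, in the form used throughout: a tolerance that works locally can
    be chosen uniformly. *)
Lemma unif_segment (P : R -> R -> Prop) :
  (forall e e' s, e' <= e -> P e s -> P e' s) ->
  (forall s, 0 <= s <= 1 -> exists2 e, 0 < e & forall s', `|s' - s| < e -> P e s') ->
  exists2 e, 0 < e & forall s, 0 <= s <= 1 -> P e s.
Proof.
move=> mon loc.
have /compact_near_coveringP/(_ R (0^'+) P _) := @segment_compact R 0 1.
case.
- move=> s; rewrite /= in_itv /= => /loc[e e0 he].
  exists (ball s e, [set e' | e' < e]) => /=.
    split; first exact: nbhsx_ballx.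
    by apply: nbhs_right_lt.
  move=> [s' e'] /= [ss' e'e]; apply: (mon e); first exact: ltW.
  by apply: he; rewrite distrC.
- move=> e /= e0 he; exists (e / 2); first by rewrite divr_gt0.
  move=> s s01; apply: (he (e / 2)) => /=.
  + by rewrite sub0r normrN gtr0_norm ?divr_gt0 // ltr_pdivrMr // ltr_pMr // ltrDl.
  + by rewrite divr_gt0.
  + by rewrite in_itv.
Qed.

(** Composition with this retraction extends an arc to the whole line, so that continuity can be
    stated without a domain. *)
Definition clamp (s : R) : R := Num.max 0 (Num.min s 1).

Lemma clampE s : clamp s = if s <= 1 then if 0 <= s then s else 0 else 1.
Proof. by rewrite /clamp maxEle minEle; case: (s <= 1); rewrite // ler01. Qed.

Lemma clamp_itv s : 0 <= clamp s <= 1.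
Proof.
by rewrite clampE; case: (leP s 1) => ?; [case: (leP 0 s) => ?|]; apply/andP; split; lra.
Qed.

Lemma clamp_id s : 0 <= s <= 1 -> clamp s = s.
Proof. by case/andP => s0 s1; rewrite clampE s1 s0. Qed.

Lemma clamp_dist s s' : `|clamp s' - clamp s| <= `|s' - s|.
Proof.
rewrite !clampE ler_norml.
case: (leP s 1) => ?; case: (leP s' 1) => ?; case: (leP 0 s) => ?; case: (leP 0 s') => ?;
  case: (ger0P (s' - s)) => ?; apply/andP; split; lra.
Qed.

Lemma eps_cont_clamp (f : R -> R * R) : {within `[0, 1], continuous f} ->
  eps_cont (fun s => (f (clamp s)).1) /\ eps_cont (fun s => (f (clamp s)).2).
Proof.
move=> /subspace_continuousP fc.
have main s e : 0 < e -> exists2 d, 0 < d & forall s', `|s' - s| < d ->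
    `|(f (clamp s')).1 - (f (clamp s)).1| < e /\ `|(f (clamp s')).2 - (f (clamp s)).2| < e.
  move=> e0; have cs : `[0, 1]%classic (clamp s) by rewrite /= in_itv /= clamp_itv.
  have /cvg_ballP/(_ e e0) := fc _ cs.
  rewrite nearE /= => /nbhs_ballP[d /= d0 hd]; exists d => // s' ss'.
  have [] : ball (f (clamp s)) e (f (clamp s')).
    apply: hd => /=; last by rewrite in_itv /= clamp_itv.
    rewrite -ball_normE /= distrC; exact: le_lt_trans (clamp_dist _ _) ss'.
  by rewrite /ball /= => h1 h2; split; rewrite distrC.
by split=> s e /(main s)[d d0 hd]; exists d => // s' /hd[].
Qed.

Lemma planar_curves (G : sgraph) : planar R G ->
  exists (px py : G -> R) (cx cy : G -> G -> R -> R),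
  [/\ forall x y, px x = px y -> py x = py y -> x = y,
      forall x y, x -- y -> [/\ eps_cont (cx x y), eps_cont (cy x y),
        cx x y 0 = px x /\ cy x y 0 = py x & cx x y 1 = px y /\ cy x y 1 = py y],
      forall x y z s, x -- y -> cx x y s = px z -> cy x y s = py z -> z = x \/ z = y
    & forall x y u v s s', x -- y -> u -- v -> [set x; y]%SET <> [set u; v]%SET ->
        cx x y s = cx u v s' -> cy x y s = cy u v s' ->
        exists z, cx x y s = px z /\ cy x y s = py z].
Proof.
move=> [pos [E [posinj arc vtx cross]]].
have : forall xy : G * G, exists f : R -> R * R, xy.1 -- xy.2 ->
    [/\ {within `[0, 1], continuous f}, f 0 = pos xy.1, f 1 = pos xy.2 &
        E [set xy.1; xy.2]%SET = f @` `[0, 1]].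
  move=> [x y]; case: (boolP (x -- y)) => [/arc[f [fc _ f0 f1 EE]]|_] /=.
    by exists f.
  by exists (fun _ => pos x).
move=> /choice[f fP].
exists (fun x => (pos x).1), (fun x => (pos x).2),
  (fun x y s => (f (x, y) (clamp s)).1), (fun x y s => (f (x, y) (clamp s)).2).
have inE' x y s : x -- y -> E [set x; y]%SET (f (x, y) (clamp s)).
  move=> xy; have [_ _ _ /= ->] := fP (x, y) xy; exists (clamp s) => //=.
  by rewrite in_itv /= clamp_itv.
have eqP2 (p q : R * R) : p.1 = q.1 -> p.2 = q.2 -> p = q.
  by case: p q => [p1 p2] [q1 q2] /= -> ->.
have c0 : clamp 0 = 0 by rewrite clamp_id ?lexx ?ler01.
have c1 : clamp 1 = 1 by rewrite clamp_id ?lexx ?ler01.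
split.
- by move=> x y h1 h2; apply: posinj; apply: eqP2.
- move=> x y xy; have [fc f0 f1 _] := fP (x, y) xy; have [h1 h2] := eps_cont_clamp fc.
  by split=> //; rewrite ?c0 ?c1 ?f0 ?f1.
- move=> x y z s xy h1 h2; apply: vtx (xy) _; rewrite -(eqP2 _ _ h1 h2); exact: inE'.
- move=> x y u v s s' xy uv nxy h1 h2; have h := eqP2 _ _ h1 h2.
  have [|z _ zE] := cross _ _ _ _ xy uv nxy (f (x, y) (clamp s)).
    by split; [exact: inE' | rewrite h; exact: inE'].
  by exists z; rewrite -zE.
Qed.

End Curves.

Definition in_box (D : nat) (c d : nat * nat) : bool :=
  [&& c.1 <= d.1 + D, d.1 <= c.1 + D, c.2 <= d.2 + D & d.2 <= c.2 + D].

Definition l1dist (c d : nat * nat) : nat := (c.1 - d.1) + (d.1 - c.1) + ((c.2 - d.2) + (d.2 - c.2)).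

(** One unit towards [d] in one coordinate. Iterated, this connects a box to its centre; the bound
    by maxima keeps the path inside the grid. *)
Lemma in_box_step D (c d : nat * nat) : c != d -> in_box D c d ->
  exists c' : nat * nat, [/\ in_box D c' d, in_box 1 c c', c.1 = c'.1 \/ c.2 = c'.2,
    (c'.1 <= maxn c.1 d.1) && (c'.2 <= maxn c.2 d.2) & l1dist c' d < l1dist c d].
Proof.
case: c d => [a b] [c d]; rewrite /in_box /l1dist xpair_eqE /= => ne bx.
have [ac|ca|ac] := ltngtP a c.
- by exists (a.+1, b) => /=; split; [lia|lia|right|lia|lia].
- by exists (a.-1, b) => /=; split; [lia|lia|right|lia|lia].
have [bd|db|bd] := ltngtP b d.
- by exists (a, b.+1) => /=; split; [lia|lia|left|lia|lia].
- by exists (a, b.-1) => /=; split; [lia|lia|left|lia|lia].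
by rewrite ac bd !eqxx in ne.
Qed.

(** * Boxes and walks as a minor of a grid *)

Section GridMinor.
Variables (G : sgraph) (N n rho : nat) (vx : G -> nat * nat) (w : G -> G -> nat -> nat * nat).

Hypothesis vx_lt : forall x, ((vx x).1 <= N) && ((vx x).2 <= N).
Hypothesis w_lt : forall x y j, x -- y -> j <= n -> ((w x y j).1 <= N) && ((w x y j).2 <= N).
Hypothesis w_fst : forall x y, x -- y -> w x y 0 = vx x.
Hypothesis w_last : forall x y, x -- y -> w x y n = vx y.
Hypothesis w_step : forall x y j, x -- y -> j < n ->
  in_box 1 (w x y j) (w x y j.+1) /\
  ((w x y j).1 = (w x y j.+1).1 \/ (w x y j).2 = (w x y j.+1).2).
Hypothesis box_disj : forall x z c, in_box rho c (vx x) -> in_box rho c (vx z) -> x = z.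
Hypothesis box_edge : forall x y z j, x -- y -> j <= n -> in_box rho (w x y j) (vx z) ->
  z = x \/ z = y.
Hypothesis edge_cross : forall x y u v j j', x -- y -> u -- v ->
  [set x; y] <> [set u; v] -> j <= n -> j' <= n -> w x y j = w u v j' ->
  exists z, in_box rho (w x y j) (vx z).

(* Each edge is oriented by [enum_rank]; the branch set of [x] is the box of [x]
   together with the initial parts, before they reach the box of the other end,
   of the walks leaving [x]. *)
Let pre x y j := forall j', j' <= j -> ~~ in_box rho (w x y j') (vx y).

Let branch x (c : nat * nat) : Prop :=
  in_box rho c (vx x) \/
  exists y j, [/\ x -- y, enum_rank x < enum_rank y, j <= n, w x y j = c & pre x y j].

(** Walks of different edges meet only in the box of a vertex, which must be an end of both; as
    neither initial part has reached its far end, that vertex is the start of both. The orientation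
    by rank excludes one edge walked from both ends. *)
Let branch_disj x z c : branch x c -> branch z c -> x = z.
Proof.
have half x' z' : in_box rho c (vx x') -> branch z' c -> x' = z'.
  move=> b [b'|[y [j [zy _ jn wj pr]]]]; first exact: box_disj b b'.
  have := b; rewrite -wj => /(box_edge zy jn)[//|xy].
  by move: (pr j (leqnn j)); rewrite wj -xy b.
move=> [b|[y [j [xy rxy jn wj pr]]]]; first exact: half.
move=> [b|[v [j' [zv rzv jn' wj' pr']]]].
  by apply/esym/half => //; right; exists y, j.
have [//|nxz] := eqVneq x z; case: notF.
have [z0 b] : exists z0, in_box rho c (vx z0).
  rewrite -wj; apply: (edge_cross xy zv _ jn jn'); last by rewrite wj wj'.
  move=> E; have : x \in [set z; v] by rewrite -E set21.
  rewrite !inE (negPf nxz) /= => /eqP xv.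
  have : y \in [set z; v] by rewrite -E set22.
  rewrite !inE -xv => /orP[/eqP yz|/eqP yx]; last by rewrite yx sedge_irrefl in xy.
  by move: rzv rxy; rewrite yz -xv => h1 h2; have := ltn_trans h1 h2; rewrite ltnn.
have zx : z0 = x.
  have := b; rewrite -wj => /(box_edge xy jn)[//|E].
  by move: (pr j (leqnn j)); rewrite wj -E b.
have zz : z0 = z.
  have := b; rewrite -wj' => /(box_edge zv jn')[//|E].
  by move: (pr' j' (leqnn j')); rewrite wj' -E b.
by rewrite -zx zz eqxx in nxz.
Qed.

Let cell (p : 'I_N.+1 * 'I_N.+1) : nat * nat := (p.1 : nat, p.2 : nat).
Let pt (c : nat * nat) : 'I_N.+1 * 'I_N.+1 := (inord c.1, inord c.2).
Let mu p : option G := [pick x | `[< branch x (cell p) >]].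

Let cellK : cancel cell pt.
Proof. by case=> i j; rewrite /pt /cell /= !inord_val. Qed.

Let ptK c : (c.1 <= N) && (c.2 <= N) -> cell (pt c) = c.
Proof. by case: c => i j /= /andP[? ?]; rewrite /cell /pt /= !inordK. Qed.

Let muE p x : (mu p == Some x) = `[< branch x (cell p) >].
Proof.
rewrite /mu; case: pickP => [z /asboolP hz|none]; last by rewrite none.
apply/eqP/asboolP => [[<-] //|hx]; by rewrite (branch_disj hx hz).
Qed.

Let in_box_refl D c : in_box D c c.
Proof. by rewrite /in_box !leq_addr. Qed.

Let fib_rel x p q := [&& grid_adj p q, mu p == Some x & mu q == Some x].

Let fib_sym x : connect_sym (fib_rel x).
Proof.
by apply: sym_connect_sym => p q; rewrite /fib_rel grid_adj_sym [(mu p == _) && _]andbC.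
Qed.

Let connect_step x p q : mu p == Some x -> mu q == Some x ->
  in_box 1 (cell p) (cell q) -> (cell p).1 = (cell q).1 \/ (cell p).2 = (cell q).2 ->
  connect (fib_rel x) p q.
Proof.
move=> mp mq bx eqs; have [->|npq] := eqVneq p q; first exact: connect0.
apply: connect1; rewrite /fib_rel mp mq !andbT.
move: bx npq; rewrite -(can_eq cellK) /in_box /grid_adj /cell xpair_eqE /=.
by case: eqs => /= h; rewrite h eqxx /=; lia.
Qed.

Let connect_box x p : in_box rho (cell p) (vx x) -> connect (fib_rel x) p (pt (vx x)).
Proof.
have [m] := ubnP (l1dist (cell p) (vx x)); elim: m p => // m IH p hm bp.
have [cE|nc] := eqVneq (cell p) (vx x); first by rewrite -cE cellK connect0.
have [c' [b1 b2 b3 b4 b5]] := in_box_step nc bp.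
have c'N : cell (pt c') = c'.
  apply: ptK; have /andP[v1 v2] := vx_lt x; case/andP: b4 => b4 b4'.
  by apply/andP; split; [apply: (leq_trans b4)|apply: (leq_trans b4')];
    rewrite geq_max ?v1 ?v2 andbT -ltnS ltn_ord.
apply: (@connect_trans _ _ (pt c')); last by apply: IH; rewrite c'N //; exact: leq_trans b5 hm.
by apply: connect_step; rewrite ?muE ?c'N //; apply/asboolP; left; rewrite ?c'N.
Qed.

Let connect_branch x p : mu p == Some x -> connect (fib_rel x) p (pt (vx x)).
Proof.
rewrite muE => /asboolP[|[y [j [xy rxy jn wj pr]]]]; first exact: connect_box.
rewrite -(cellK p) -wj; move: jn pr {p wj}; elim: j => [|j IH] jn pr.
  by rewrite w_fst ?connect0.
have hj : branch x (w x y j).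
  by right; exists y, j; split=> //; [exact: ltnW | move=> j' j'j; apply/pr/leqW].
have hj1 : branch x (w x y j.+1) by right; exists y, j.+1.
have cK i : i <= n -> cell (pt (w x y i)) = w x y i by move=> ?; apply/ptK/w_lt.
apply: connect_trans (IH (ltnW jn) _); last by move=> j' j'j; apply/pr/leqW.
have [b1 b2] := w_step xy jn.
rewrite fib_sym; apply: connect_step; rewrite ?muE ?cK //; try exact: ltnW;
  by apply/asboolP.
Qed.

Lemma grid_minor : has_dual (@sedge G).
Proof.
apply: (minor_dual (mu := mu) _ _ _ _ _ _ (@grid_dual N.+1)).
- exact: grid_adj_sym.
- exact: grid_adj_irrefl.
- exact: sedge_sym.
- exact: sedge_irrefl.
- move=> p q x /eqP mp /eqP mq; apply: (connect_trans (connect_branch mp)).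
  by rewrite fib_sym; apply: connect_branch.
have main x y : x -- y -> enum_rank x < enum_rank y ->
    exists p q, [/\ grid_adj p q, mu p = Some x & mu q = Some y].
  move=> xy rxy.
  have exj : exists j, in_box rho (w x y j) (vx y) by exists n; rewrite w_last // in_box_refl.
  (* At the first entry into the box of [y], the preceding cell still belongs to the branch set of
     [x]: this step is the host edge sought. *)
  case: (ex_minnP exj) => -[|j] hj jmin.
    case: notF; move: hj; rewrite w_fst // => /(box_disj (in_box_refl _ _)) E.
    by rewrite E sedge_irrefl in xy.
  have jn : j < n by apply: jmin; rewrite w_last // in_box_refl.
  have pr : pre x y j.
    by move=> j' j'j; apply/negP => /jmin; rewrite ltnNge j'j.
  have cK i : i <= n -> cell (pt (w x y i)) = w x y i by move=> ?; apply/ptK/w_lt.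
  exists (pt (w x y j)), (pt (w x y j.+1)).
  have mj : mu (pt (w x y j)) = Some x.
    by apply/eqP; rewrite muE cK ?(ltnW jn) //; apply/asboolP; right; exists y, j; split=> //; exact: ltnW.
  have mj1 : mu (pt (w x y j.+1)) = Some y.
    by apply/eqP; rewrite muE cK //; apply/asboolP; left.
  split=> //.
  have [b1 b2] := w_step xy jn.
  have ne : w x y j != w x y j.+1.
    by apply/eqP => E; move: (pr j (leqnn j)); rewrite E hj.
  have := cK j.+1 jn; have := cK j (ltnW jn).
  move: (pt (w x y j)) (pt (w x y j.+1)) => p q; rewrite /grid_adj /cell => E2 E1.
  move: ne b1 b2; rewrite -E1 -E2 xpair_eqE /in_box /= => ne b1 [] h; rewrite h eqxx in ne b1 *; lia.
move=> x y xy; have [rxy|ryx|/val_inj/enum_rank_inj E] := ltngtP (enum_rank x) (enum_rank y).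
- exact: main.
- have [|q [p [h1 h2 h3]]] := main y x _ ryx; first by rewrite sedge_sym.
  by exists p, q; rewrite grid_adj_sym.
- by rewrite E sedge_irrefl in xy.
Qed.

End GridMinor.

(** * Uniform separation of arcs *)

Section Discretize.
Local Open Scope ring_scope.
Variable R : realType.

Lemma fin_uniform (I : finType) (P : I -> R -> Prop) :
  (forall i e e', e' <= e -> P i e -> P i e') ->
  (forall i, exists2 e, 0 < e & P i e) -> exists2 e, 0 < e & forall i, P i e.
Proof.
move=> mon loc.
have : forall i, exists e, 0 < e /\ P i e by move=> i; have [e e0 h] := loc i; exists e.
move=> /choice[f fP]; exists (\big[Num.min/1]_i f i).
  by elim/big_rec: _ => // i x _ x0; rewrite lt_min x0 (fP i).1.
by move=> i; apply: mon (fP i).2; apply: bigmin_le_cond.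
Qed.

Lemma point_away (f g : R -> R) (a b : R) : eps_cont f -> eps_cont g ->
  (forall s, f s = a -> g s = b -> False) ->
  exists2 e, 0 < e & forall s, 0 <= s <= 1 -> `|f s - a| < e -> `|g s - b| < e -> False.
Proof.
move=> fc gc ne; apply: (unif_segment (P := fun e s => `|f s - a| < e -> `|g s - b| < e -> False)).
  by move=> e e' s ee h h1 h2; apply: h; [exact: lt_le_trans ee|exact: lt_le_trans ee].
move=> s _.
have aux (h : R -> R) (c : R) : eps_cont h -> h s != c ->
    exists2 e, 0 < e & forall s', `|s' - s| < e -> `|h s' - c| < e -> False.
  move=> hc hs; have d0 : 0 < `|h s - c| / 2 by rewrite divr_gt0 // normr_gt0 subr_eq0.
  have [d d1 hd] := hc s _ d0.
  exists (Num.min d (`|h s - c| / 2)); first by rewrite lt_min d1.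
  move=> s'; rewrite !lt_min => /andP[/hd h1 _] /andP[_ h2].
  have := ler_normD (h s - h s') (h s' - c); rewrite subrKA [`|h s - h s'|]distrC; lra.
have [fs|/(aux _ _ fc)[e e0 h]] := eqVneq (f s) a; last by exists e => // s' /h.
have [gs|/(aux _ _ gc)[e e0 h]] := eqVneq (g s) b; last by exists e => // s' /h h' _.
by have := ne s fs gs.
Qed.

(** Compactness used twice, for the second parameter near a fixed first one and then for the first:
    arcs that meet only over the open set [W] stay a positive distance apart elsewhere. *)
Lemma curves_away (f g f' g' : R -> R) (W : R -> Prop) :
  eps_cont f -> eps_cont g -> eps_cont f' -> eps_cont g' ->
  (forall s, W s -> exists2 d, 0 < d & forall s', `|s' - s| < d -> W s') ->
  (forall s s', f s = f' s' -> g s = g' s' -> W s) ->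
  exists2 e, 0 < e & forall s s', 0 <= s <= 1 -> 0 <= s' <= 1 ->
    `|f s - f' s'| < e -> `|g s - g' s'| < e -> W s.
Proof.
move=> fc gc fc' gc' Wo meet.
pose Q e s s' := `|f s - f' s'| < e -> `|g s - g' s'| < e -> W s.
have Qmon e e' s s' : e' <= e -> Q e s s' -> Q e' s s'.
  by move=> ee h h1 h2; apply: h; [exact: lt_le_trans ee|exact: lt_le_trans ee].
suff [e e0 h] : exists2 e, 0 < e & forall s, 0 <= s <= 1 -> forall s', 0 <= s' <= 1 -> Q e s s'.
  by exists e => // s s' hs hs'; exact: h.
apply: (unif_segment (P := fun e s => forall s', 0 <= s' <= 1 -> Q e s s')).
  by move=> e e' s ee h s' /h; exact: Qmon.
move=> s s01.
suff [e e0 h] : exists2 e, 0 < e & forall s', 0 <= s' <= 1 ->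
    forall s2, `|s2 - s| < e -> Q e s2 s'.
  by exists e => // s2 hs2 s' /h; exact.
apply: (unif_segment (P := fun e s' => forall s2, `|s2 - s| < e -> Q e s2 s')).
  by move=> e e' s' ee h s2 hs2; apply: Qmon (ee) _; apply: h; exact: lt_le_trans ee.
move=> s' _.
have aux (h h' : R -> R) : eps_cont h -> eps_cont h' -> h s != h' s' ->
    exists2 e, 0 < e & forall s1, `|s1 - s'| < e -> forall s2, `|s2 - s| < e ->
      `|h s2 - h' s1| < e -> False.
  move=> hc hc' hs; have d0 : 0 < `|h s - h' s'| / 3 by rewrite divr_gt0 // normr_gt0 subr_eq0.
  have [d d1 hd] := hc s _ d0; have [d' d1' hd'] := hc' s' _ d0.
  exists (Num.min (Num.min d d') (`|h s - h' s'| / 3)); first by rewrite !lt_min d1 d1' d0.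
  move=> s1; rewrite !lt_min => /andP[/andP[_ /hd' h1] _] s2.
  rewrite !lt_min => /andP[/andP[/hd h2 _] _] /andP[_ h3].
  have := ler_normD (h s - h s2) (h s2 - h' s'); rewrite subrKA [`|h s - h s2|]distrC.
  have := ler_normD (h s2 - h' s1) (h' s1 - h' s'); rewrite subrKA; lra.
have [fs|/(aux _ _ fc fc')[e e0 h]] := eqVneq (f s) (f' s'); last first.
  by exists e => // s1 /h h1 s2 /h1 h2 /h2.
have [gs|/(aux _ _ gc gc')[e e0 h]] := eqVneq (g s) (g' s'); last first.
  by exists e => // s1 /h h1 s2 /h1 h2 _ /h2.
have [d d0 hd] := Wo s (meet s s' fs gs).
by exists d => // s1 _ s2 /hd Ws _ _.
Qed.

Lemma unif_cont (f : R -> R) (eta : R) : eps_cont f -> 0 < eta ->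
  exists2 e, 0 < e & forall s, 0 <= s <= 1 -> forall s', `|s' - s| < e -> `|f s' - f s| < eta.
Proof.
move=> fc eta0.
apply: (unif_segment (P := fun e s => forall s', `|s' - s| < e -> `|f s' - f s| < eta)).
  by move=> e e' s ee h s' hs'; apply: h; exact: lt_le_trans ee.
move=> s _; have [d d0 hd] := fc s (eta / 2) (divr_gt0 eta0 (ltr0n _ 2)).
exists (d / 2) => [|s1 h1 s2 h2]; first by rewrite divr_gt0.
have h3 : `|s2 - s| < d.
  by have := ler_normD (s2 - s1) (s1 - s); rewrite subrKA; lra.
have h4 : `|s1 - s| < d by lra.
have := ler_normD (f s2 - f s) (f s - f s1); rewrite subrKA [`|f s - _|]distrC.
by have := hd _ h3; have := hd _ h4; lra.
Qed.

(** Boundedness, written with a small factor so that it is monotone in [e], as [unif_segment] and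
    [fin_uniform] require. *)
Lemma unif_bounded (f : R -> R) : eps_cont f ->
  exists2 e, 0 < e & forall s, 0 <= s <= 1 -> `|f s| * e < 1.
Proof.
move=> fc; apply: (unif_segment (P := fun e s => `|f s| * e < 1)).
  move=> e e' s ee; apply: le_lt_trans; exact: ler_wpM2l.
move=> s _; have [d d0 hd] := fc s 1 ltr01.
have a0 : 0 < `|f s| + 2 by rewrite ltr_wpDl.
exists (Num.min d (`|f s| + 2)^-1); first by rewrite lt_min d0 invr_gt0.
move=> s'; rewrite lt_min => /andP[/hd h _].
apply: (@le_lt_trans _ _ (`|f s'| * (`|f s| + 2)^-1)).
  by apply: ler_wpM2l => //; rewrite ge_min lexx orbT.
rewrite ltr_pdivrMr // mul1r.
by have := ler_normD (f s' - f s) (f s); rewrite subrK; lra.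
Qed.

End Discretize.

Lemma half_bounds n j : j <= n.*2 -> uphalf j <= n /\ j./2 <= n.
Proof. lia. Qed.

Lemma half_odd_step n j : odd j -> j < n.*2 ->
  [/\ uphalf j = (j./2).+1, uphalf j.+1 = uphalf j, (j.+1)./2 = (j./2).+1 & j./2 < n].
Proof. by move=> jo jn; split; lia. Qed.

Lemma half_even_step n j : ~~ odd j -> j < n.*2 ->
  [/\ uphalf j = j./2, uphalf j.+1 = (uphalf j).+1, (j.+1)./2 = j./2 & uphalf j < n].
Proof. by move=> jo jn; split; lia. Qed.

Lemma box_double m a b c : [&& c <= a + m, a <= c + m, c <= b + m & b <= c + m] ->
  a <= b + (m + m) /\ b <= a + (m + m).
Proof. lia. Qed.

(** * Discretizing a plane drawing *)

Section PlanarDual.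
Local Open Scope ring_scope.
Variable R : realType.

Section Cell.
Variables (M ep : R).
Hypothesis ep0 : 0 < ep.
Let cell (u : R) : nat := Num.truncn ((u + M) / ep).

Let cell_itv u : `|u| < M -> (cell u)%:R * ep <= u + M < ((cell u)%:R + 1) * ep.
Proof.
rewrite ltr_norml => /andP[u1 u2].
have /truncn_itv : 0 <= (u + M) / ep by rewrite divr_ge0 ?ltW //; lra.
by rewrite ler_pdivlMr // ltr_pdivrMr // -/(cell u) -natr1.
Qed.

Lemma cell_close u u' D : `|u| < M -> `|u'| < M -> `|u - u'| < D%:R * ep ->
  (cell u <= cell u' + D)%N.
Proof.
move=> /cell_itv/andP[h1 h2] /cell_itv/andP[h3 h4]; rewrite ltr_norml => /andP[h5 h6].
rewrite -ltnS -(ltr_nat R) -natr1 natrD -(ltr_pM2r ep0) !mulrDl mul1r.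
by rewrite !mulrDl mul1r in h4; lra.
Qed.

Lemma close_of_cell u u' D : `|u| < M -> `|u'| < M ->
  (cell u <= cell u' + D)%N -> (cell u' <= cell u + D)%N -> `|u - u'| < (D%:R + 1) * ep.
Proof.
move=> /cell_itv/andP[h1 h2] /cell_itv/andP[h3 h4].
rewrite -!(ler_nat R) !natrD => h5 h6; move: h2 h4 (ler_wpM2r (ltW ep0) h5) (ler_wpM2r (ltW ep0) h6).
rewrite !mulrDl !mul1r => *.
by rewrite ltr_norml; apply/andP; split; lra.
Qed.

Lemma cell_le u : `|u| < M -> (cell u <= Num.truncn ((M + M) / ep))%N.
Proof.
rewrite ltr_norml => /andP[u1 u2]; apply: le_truncn.
by rewrite ler_pM2r ?invr_gt0 //; lra.
Qed.

End Cell.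

Lemma dist_lt_trans (x y z b c d : R) :
  `|x - y| < b -> `|y - z| <= c -> b + c <= d -> `|x - z| < d.
Proof. by have := ler_normD (x - y) (y - z); rewrite subrKA; lra. Qed.

Lemma planar_dual (G : sgraph) : planar R G -> has_dual (@sedge G).
Proof.
move=> /planar_curves[px [py [cx [cy [pinj edge vtx cross]]]]].
have [rA rA0 hA] : exists2 e, 0 < e & forall xz : G * G, xz.1 != xz.2 ->
    `|px xz.1 - px xz.2| < e -> `|py xz.1 - py xz.2| < e -> False.
  apply: fin_uniform => [[x z] e e' ee /= h nxz h1 h2|[x z] /=].
    by apply: h => //; [exact: lt_le_trans ee|exact: lt_le_trans ee].
  have [->|nxz] := eqVneq x z; first by exists 1.
  have [E|ne] := eqVneq (px x) (px z).
    have ne : py x != py z by apply: contra_neq nxz; exact: pinj.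
    exists `|py x - py z|; first by rewrite normr_gt0 subr_eq0.
    by move=> _ _; rewrite ltxx.
  exists `|px x - px z|; first by rewrite normr_gt0 subr_eq0.
  by move=> _; rewrite ltxx.
have [rB rB0 hB] : exists2 e, 0 < e & forall t : G * G * G, t.1.1 -- t.1.2 ->
    t.2 != t.1.1 -> t.2 != t.1.2 -> forall s, 0 <= s <= 1 ->
    `|cx t.1.1 t.1.2 s - px t.2| < e -> `|cy t.1.1 t.1.2 s - py t.2| < e -> False.
  apply: fin_uniform => [[[x y] z] e e' ee /= h xy zx zy s s01 h1 h2|[[x y] z] /=].
    by apply: (h xy zx zy s s01); exact: lt_le_trans ee.
  case: (boolP (x -- y)) => [xy|_]; last by exists 1.
  have [->|zx] := eqVneq z x; first by exists 1.
  have [->|zy] := eqVneq z y; first by exists 1.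
  have [cxc cyc _ _] := edge x y xy.
  have [|e e0 h] := @point_away R (cx x y) (cy x y) (px z) (py z) cxc cyc.
    by move=> s h1 h2; have [] := vtx x y z s xy h1 h2 => E; move: zx zy; rewrite E eqxx.
  by exists e => // _ _ _; exact: h.
(* [rA] separates the vertices from each other, [rB] the vertices from arcs not ending there. The
   quarter leaves room for two box radii and rounding. *)
pose r := Num.min rA rB / 4.
have r0 : 0 < r by rewrite divr_gt0 // lt_min rA0.
have r4 : (4 * r <= rA) && (4 * r <= rB).
  by rewrite /r mulrC divfK // !ge_min !lexx orbT.
case/andP: r4 => r4A r4B.
have [dl dl0 hC] : exists2 e, 0 < e & forall q : G * G * (G * G),
    q.1.1 -- q.1.2 -> q.2.1 -- q.2.2 -> [set q.1.1; q.1.2] <> [set q.2.1; q.2.2] ->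
    forall s s', 0 <= s <= 1 -> 0 <= s' <= 1 ->
    `|cx q.1.1 q.1.2 s - cx q.2.1 q.2.2 s'| < e ->
    `|cy q.1.1 q.1.2 s - cy q.2.1 q.2.2 s'| < e ->
    exists z, `|cx q.1.1 q.1.2 s - px z| < r /\ `|cy q.1.1 q.1.2 s - py z| < r.
  apply: fin_uniform => [[[x y] [u v]] e e' ee /= h xy uv ne s s' s01 s01' h1 h2|[[x y] [u v]] /=].
    by apply: (h xy uv ne s s' s01 s01'); exact: lt_le_trans ee.
  case: (boolP (x -- y)) => [xy|_]; last by exists 1.
  case: (boolP (u -- v)) => [uv|_]; last by exists 1.
  have [ne|ne] := pselect ([set x; y] <> [set u; v]); last by exists 1 => // _ _ /ne.
  have [cxc cyc _ _] := edge x y xy; have [cxc' cyc' _ _] := edge u v uv.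
  pose W s := exists z, `|cx x y s - px z| < r /\ `|cy x y s - py z| < r.
  have [||e e0 h] := @curves_away R _ _ _ _ W cxc cyc cxc' cyc'.
  - move=> s [z [h1 h2]].
    have [d1 d10 hd1] := cxc s (r - `|cx x y s - px z|) ltac:(by rewrite subr_gt0).
    have [d2 d20 hd2] := cyc s (r - `|cy x y s - py z|) ltac:(by rewrite subr_gt0).
    exists (Num.min d1 d2); first by rewrite lt_min d10.
    move=> s'; rewrite lt_min => /andP[/hd1 h3 /hd2 h4]; exists z; split.
      by apply: dist_lt_trans h3 (lexx _) _; rewrite subrK.
    by apply: dist_lt_trans h4 (lexx _) _; rewrite subrK.
  - move=> s s' h1 h2; have [z [z1 z2]] := cross x y u v s s' xy uv ne h1 h2.
    by exists z; rewrite z1 z2 !subrr normr0.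
  by exists e => // _ _ _; exact: h.
have [eM eM0 hM] : exists2 e, 0 < e & forall xy : G * G, xy.1 -- xy.2 ->
    forall s, 0 <= s <= 1 -> `|cx xy.1 xy.2 s| * e < 1 /\ `|cy xy.1 xy.2 s| * e < 1.
  apply: fin_uniform => [[x y] e e' ee /= h xy s s01|[x y] /=].
    have [h1 h2] := h xy s s01.
    by split; [apply: le_lt_trans h1|apply: le_lt_trans h2]; apply: ler_wpM2l.
  case: (boolP (x -- y)) => [xy|_]; last by exists 1.
  have [cxc cyc _ _] := edge x y xy.
  have [e1 e10 h1] := unif_bounded cxc; have [e2 e20 h2] := unif_bounded cyc.
  exists (Num.min e1 e2); first by rewrite lt_min e10.
  move=> _ s s01; split; [apply: le_lt_trans (h1 s s01)|apply: le_lt_trans (h2 s s01)];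
    by apply: ler_wpM2l => //; rewrite ge_min lexx ?orbT.
have [eV eV0 hV] : exists2 e, 0 < e & forall x : G, `|px x| * e < 1 /\ `|py x| * e < 1.
  apply: fin_uniform => [x e e' ee [h1 h2]|x].
    by split; [apply: le_lt_trans h1|apply: le_lt_trans h2]; apply: ler_wpM2l.
  have a0 : 0 < `|px x| + `|py x| + 1 by rewrite ltr_wpDl // addr_ge0.
  exists (`|px x| + `|py x| + 1)^-1; first by rewrite invr_gt0.
  rewrite !ltr_pdivrMr // !mul1r; have := normr_ge0 (px x); have := normr_ge0 (py x).
  by split; lra.
pose M := (Num.min eM eV)^-1.
have m0 : 0 < Num.min eM eV by rewrite lt_min eM0.
have ltM (u e : R) : 0 < e -> Num.min eM eV <= e -> `|u| * e < 1 -> `|u| < M.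
  move=> e0 me h; rewrite /M -div1r ltr_pdivlMr //.
  by apply: le_lt_trans h; apply: ler_wpM2l.
have cxM x y s : x -- y -> 0 <= s <= 1 -> `|cx x y s| < M /\ `|cy x y s| < M.
  move=> xy s01; have [h1 h2] := hM (x, y) xy s s01.
  by split; apply: (ltM _ eM) => //; rewrite ge_min lexx.
have pxM x : `|px x| < M /\ `|py x| < M.
  by have [h1 h2] := hV x; split; apply: (ltM _ eV) => //; rewrite ge_min lexx orbT.
(* [r] measures [m] mesh widths [ep], and boxes get radius [m.+1]. From [m >= 2] follows
   [2 * m.+1 + 1 <= 4 * m], whence disjoint boxes. Points of two walks in one cell come from arc
   points less than [3 * ep <= dl] apart: one width for the cell and one for each walk whose
   coordinates are out of step. *)
pose m := (Num.truncn (3 * r / dl)).+2.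
pose ep := r / m%:R.
have mpos : 0 < m%:R :> R by rewrite ltr0n.
have ep0 : 0 < ep by rewrite divr_gt0.
have rE : r = m%:R * ep by rewrite /ep mulrC divfK // gt_eqF.
have m2 : 2 <= m%:R :> R by rewrite ler_nat.
have ep3 : 3 * ep <= dl.
  have /truncn_itv/andP[_] : 0 <= 3 * r / dl by apply: divr_ge0; [apply: mulr_ge0 => //|]; exact: ltW.
  rewrite ltr_pdivrMr // => h; rewrite -(ler_pM2r mpos) -mulrA [ep * _]mulrC -rE.
  apply: ltW; apply: lt_le_trans h _; rewrite mulrC ler_pM2l // ler_nat; exact: leqnSn.
have [e5 e50 h5] : exists2 e, 0 < e & forall xy : G * G, xy.1 -- xy.2 ->
    forall s, 0 <= s <= 1 -> forall s', `|s' - s| < e ->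
    `|cx xy.1 xy.2 s' - cx xy.1 xy.2 s| < ep /\ `|cy xy.1 xy.2 s' - cy xy.1 xy.2 s| < ep.
  apply: fin_uniform => [[x y] e e' ee /= h xy s s01 s' hs'|[x y] /=].
    by apply: h => //; exact: lt_le_trans ee.
  case: (boolP (x -- y)) => [xy|_]; last by exists 1.
  have [cxc cyc _ _] := edge x y xy.
  have [e1 e10 h1] := unif_cont cxc ep0; have [e2 e20 h2] := unif_cont cyc ep0.
  exists (Num.min e1 e2); first by rewrite lt_min e10.
  by move=> _ s s01 s'; rewrite lt_min => /andP[/(h1 s s01) ? /(h2 s s01)].
pose n := (Num.truncn e5^-1).+1.
have npos : 0 < n%:R :> R by rewrite ltr0n.
have n5 : n%:R^-1 < e5.
  have /truncn_itv/andP[_] : 0 <= e5^-1 by rewrite invr_ge0 ltW.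
  by rewrite -/n => h; rewrite -[e5]invrK ltf_pV2 // posrE invr_gt0.
pose node i : R := i%:R / n%:R.
have node01 i : (i <= n)%N -> 0 <= node i <= 1.
  by move=> iN; rewrite /node divr_ge0 //= ler_pdivrMr // mul1r ler_nat.
have nodeS x y i : x -- y -> (i < n)%N ->
    `|cx x y (node i.+1) - cx x y (node i)| < ep /\ `|cy x y (node i.+1) - cy x y (node i)| < ep.
  move=> xy iN; apply: (h5 (x, y)) => //; first by apply/node01/ltnW.
  by rewrite /node -mulrBl -natr1 addrC addKr mul1r gtr0_norm // invr_gt0.
pose cell (u : R) : nat := Num.truncn ((u + M) / ep).
pose vx x := (cell (px x), cell (py x)).
(* Each step along the arc is split in two, so that only one coordinate changes at a time, as grid
   adjacency demands. *)
pose w x y j := (cell (cx x y (node (uphalf j))), cell (cy x y (node j./2))).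
have upn j : (j <= n.*2)%N -> (uphalf j <= n)%N /\ (j./2 <= n)%N by exact: half_bounds.
(* the first coordinate of [w x y j] may run one node ahead of the second *)
have near_half x y j : x -- y -> (j <= n.*2)%N ->
    `|cx x y (node (uphalf j)) - cx x y (node j./2)| < ep.
  have [jo|je] := boolP (odd j) => xy; rewrite leq_eqVlt => /orP[/eqP jn|jn].
  - by rewrite jn odd_double in jo.
  - by have [-> _ _ un] := half_odd_step jo jn; exact: (nodeS x y _ xy un).1.
  - by rewrite jn uphalf_double doubleK subrr normr0.
  - by have [-> _ _ _] := half_even_step je jn; rewrite subrr normr0.
apply: (@grid_minor G (Num.truncn ((M + M) / ep)) n.*2 m.+1 vx w).
- by move=> x; have [h1 h2] := pxM x; rewrite !cell_le.
- move=> x y j xy /upn[j1 j2]; have [h1 _] := cxM x y _ xy (node01 _ j1).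
  by have [_ h2] := cxM x y _ xy (node01 _ j2); rewrite !cell_le.
- move=> x y xy; have [_ _ [e1 e2] _] := edge x y xy.
  by rewrite /w /vx /node /= mul0r e1 e2.
- move=> x y xy; have [_ _ _ [e1 e2]] := edge x y xy.
  by rewrite /w /vx /node uphalf_double doubleK divff ?gt_eqF // e1 e2.
- move=> x y j xy jn.
  have sub1 u : (u < n)%N -> in_box 1 (cell (cx x y (node u)), 0%N) (cell (cx x y (node u.+1)), 0%N)
      /\ in_box 1 (0%N, cell (cy x y (node u))) (0%N, cell (cy x y (node u.+1))).
    move=> un; have [a1 a2] := cxM x y _ xy (node01 _ (ltnW un)).
    have [b1 b2] := cxM x y _ xy (node01 _ un); have [c1 c2] := nodeS x y u xy un.
    rewrite /in_box /= !leq0n !andbT.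
    by split; apply/andP; split; apply: cell_close => //; rewrite mul1r // distrC.
  rewrite /w; have [jo|je] := boolP (odd j).
    have [_ -> -> un] := half_odd_step jo jn.
    have [_] := sub1 _ un; rewrite /in_box /= !leq_addr /= => ->.
    by split=> //; left.
  have [_ -> -> un] := half_even_step je jn.
  have [+ _] := sub1 _ un; rewrite /in_box /= !leq_addr !andbT => ->.
  by split=> //; right.
- move=> x z c; rewrite /in_box /vx /= => /and4P[a1 a2 a3 a4] /and4P[b1 b2 b3 b4].
  have [|xz1 zx1] := @box_double m.+1 (cell (px x)) (cell (px z)) c.1; first by apply/and4P.
  have [|xz2 zx2] := @box_double m.+1 (cell (py x)) (cell (py z)) c.2; first by apply/and4P.
  have [x1 x2] := pxM x; have [z1 z2] := pxM z.
  have lim : ((m.+1 + m.+1)%N%:R + 1) * ep <= rA.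
    by apply: le_trans r4A; rewrite rE natrD -natr1 mulrA ler_pM2r //; move: m2; clear; lra.
  apply/eqP; apply: contraT => nxz; case: (hA (x, z) nxz) => /=; apply: lt_le_trans lim.
    exact: (close_of_cell ep0 x1 z1 xz1 zx1).
  exact: (close_of_cell ep0 x2 z2 xz2 zx2).
- move=> x y z j xy jn; rewrite /in_box /w /vx /= => /and4P[b1 b2 b3 b4].
  have [z1 z2] := pxM z; have [up1 up2] := upn j jn.
  have [x1 _] := cxM x y _ xy (node01 _ up1); have [_ x2] := cxM x y _ xy (node01 _ up2).
  have lim : ep + (m.+1%:R + 1) * ep <= rB.
    apply: le_trans r4B; rewrite rE -natr1 mulrA -[X in X + _]mul1r -mulrDl ler_pM2r //.
    by move: m2; clear; lra.
  have [->|zx] := eqVneq z x; first by left.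
  have [->|zy] := eqVneq z y; first by right.
  case: (hB (x, y, z) xy zx zy _ (node01 _ up2)) => /=.
    apply: dist_lt_trans (ltW (close_of_cell ep0 x1 z1 b1 b2)) lim.
    by rewrite distrC; exact: near_half.
  apply: lt_le_trans (close_of_cell ep0 x2 z2 b3 b4) (le_trans _ lim).
  by rewrite lerDr ltW.
- move=> x y u v j j' xy uv ne jn jn'; rewrite /w => -[e1 e2].
  have [up1 up2] := upn j jn; have [up1' up2'] := upn j' jn'.
  have [x1 _] := cxM x y _ xy (node01 _ up1); have [_ x2] := cxM x y _ xy (node01 _ up2).
  have [x1' _] := cxM u v _ uv (node01 _ up1'); have [_ x2'] := cxM u v _ uv (node01 _ up2').
  have := @close_of_cell M ep ep0 _ _ 0 x1 x1'; rewrite -/(cell _) -/(cell _) e1 addn0 add0r mul1r => /(_ (leqnn _) (leqnn _)) h1.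
  have := @close_of_cell M ep ep0 _ _ 0 x2 x2'; rewrite -/(cell _) -/(cell _) e2 addn0 add0r mul1r => /(_ (leqnn _) (leqnn _)) h2.
  have n1 := near_half x y j xy jn; have n2 := near_half u v j' uv jn'.
  have [|//|z [z1 z2]] := hC (x, y, (u, v)) xy uv ne _ _ (node01 _ up2) (node01 _ up2') _ _ => /=.
  + rewrite distrC in n1; apply: dist_lt_trans n1 (ltW (dist_lt_trans h1 (ltW n2) (lexx _))) _.
    by move: ep3; clear; lra.
  + by apply: lt_le_trans h2 (le_trans _ ep3); move: ep0; clear; lra.
  exists z; have [p1 p2] := pxM z; rewrite /in_box /vx /=.
  have d1 : `|cx x y (node (uphalf j)) - px z| < m.+1%:R * ep.
    by apply: dist_lt_trans n1 (ltW z1) _; rewrite -natr1 mulrDl mul1r -rE addrC.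
  have d2 : `|cy x y (node j./2) - py z| < m.+1%:R * ep.
    by apply: lt_le_trans z2 _; rewrite -natr1 mulrDl mul1r -rE lerDl ltW.
  rewrite -e1 -e2; apply/and4P; split; [exact: (cell_close ep0 x1 p1 d1)| |exact: (cell_close ep0 x2 p2 d2)|].
    by apply: (cell_close ep0 p1 x1); rewrite distrC.
  by apply: (cell_close ep0 p2 x2); rewrite distrC.
Qed.

End PlanarDual.

(** * Cores and threads *)

Section Cycles.
Variables (T : finType) (e : rel T).
Hypothesis ei : irreflexive e.

Lemma path_iota (v : nat -> T) i m : (forall j, i <= j < i + m -> e (v j) (v j.+1)) ->
  path e (v i) (map v (iota i.+1 m)).
Proof.
elim: m i => //= m IH i h; rewrite h; last by lia.
by apply: IH => j hj; apply: h; lia.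
Qed.

(** Before the first repeated vertex the walk is injective, so the stretch between the two
    occurrences is a cycle; it has length at least 3 since there are no loops and no immediate
    reversals. *)
Lemma nb_walk_cycle (v : nat -> T) n :
  (forall i, i < n -> e (v i) (v i.+1)) -> (forall i, i.+1 < n -> v i.+2 != v i) ->
  (exists i j, [/\ i < j, j <= n & v i = v j]) ->
  exists c, [/\ ucycle e c, 2 < size c & size c <= n].
Proof.
move=> ev nb [i0 [j0 [ij0 jn0 vv0]]].
have ex : exists j, [exists i : 'I_j, v i == v j].
  by exists j0; apply/existsP; exists (Ordinal ij0); rewrite vv0.
case: (ex_minnP ex) => j /existsP[[i ij] /= /eqP vij] jmin.
have jn : j <= n.
  by apply: leq_trans jn0; apply: jmin; apply/existsP; exists (Ordinal ij0); rewrite vv0.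
have inj a b : a < j -> b < j -> v a = v b -> a = b.
  have half a' b' : a' < b' -> b' < j -> v a' <> v b'.
    move=> ab bj vab; suff : j <= b' by rewrite leqNgt bj.
    by apply: jmin; apply/existsP; exists (Ordinal ab); rewrite vab.
  move=> aj bj vab; case: (ltngtP a b) => // ab; first by case: (half _ _ ab bj vab).
  by case: (half _ _ ab aj (esym vab)).
exists (map v (iota i (j - i))); rewrite size_map size_iota; split.
- apply/andP; split.
    have -> : j - i = (j - i).-1.+1 by rewrite prednK // subn_gt0.
    rewrite /= -[X in rcons _ X]/(v i) vij -map_rcons.
    have -> : rcons (iota i.+1 (j - i).-1) j = iota i.+1 (j - i).
      have -> : iota i.+1 (j - i) = iota i.+1 ((j - i).-1 + 1) by congr iota; lia.
      by rewrite iotaD cats1; congr rcons; lia.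
    rewrite -vij; apply: path_iota => b /andP[_ bj]; apply: ev.
    by apply: leq_trans jn; lia.
  rewrite map_inj_in_uniq ?iota_uniq // => a b.
  by rewrite !mem_iota => ha hb; apply: inj; lia.
- rewrite ltnNge; apply/negP => small.
  have [j1|j2] : j = i.+1 \/ j = i.+2 by lia.
    by have := ev i; rewrite -j1 -vij ei => /(_ jn).
  by have := nb i; rewrite -j2 vij eqxx => /(_ _)/negP; apply; lia.
- by apply: leq_trans (leq_subr _ _) jn.
Qed.

Lemma no_leaf_cycle x0 y0 : e x0 y0 -> (forall x y, e x y -> exists z, e y z && (z != x)) ->
  exists c, ucycle e c /\ 2 < size c.
Proof.
move=> e0 next.
pose nx (u : T * T) := (u.2, odflt u.1 [pick z | e u.2 z && (z != u.1)]).
have nxP u : e u.1 u.2 -> e (nx u).1 (nx u).2 && ((nx u).2 != u.1).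
  by move=> eu; rewrite /nx /=; case: pickP => //= none; have [z] := next _ _ eu; rewrite none.
pose u i := iter i nx (x0, y0); pose v i := (u i).1.
have eu i : e (u i).1 (u i).2 by elim: i => //= i /nxP/andP[].
have [|||c [c1 c2 _]] := @nb_walk_cycle v #|T|; last by exists c.
- by move=> i _; exact: eu.
- by move=> i _; have /andP[_] := nxP _ (eu i).
- have /injectivePn[a [b nab vab]] : ~~ injectiveb (fun i : 'I_#|T|.+1 => v i).
    by apply/injectiveP => /leq_card; rewrite card_ord ltnn.
  have [ab|ba|/val_inj E] := ltngtP a b; last by rewrite E eqxx in nab.
    by exists a, b; split=> //; rewrite -ltnS.
  by exists b, a; split=> //; rewrite -ltnS.
Qed.

End Cycles.

(** The support of a nonzero cycle vector has no leaf, so it contains a cycle; each of the at least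
    [g] vertices on it begins two darts of the support. *)
Lemma girth_euler (T : finType) (e : rel T) (C : {set T}) (g : nat) :
  symmetric e -> irreflexive e -> has_dual e ->
  (forall x y, e x y -> x \in C) -> C != set0 ->
  (forall c, ucycle e c -> 2 < size c -> g <= size c) ->
  (#|[set u : T * T | e u.1 u.2]| + 2 - 2 * #|C|) * g <=
    2 * #|[set u : T * T | e u.1 u.2]|.
Proof.
move=> es ei ed eC C0 hg; apply: dual_euler => // k [ks k0 kd] [p0 [q0 kpq0]].
pose r p q := (k p q != 0)%R.
have rs : symmetric r by move=> p q; rewrite /r ks.
have re p q : r p q -> e p q by apply: contraR => /k0 ->.
have ri : irreflexive r by move=> p; apply: contraTF (isT) => h; have := re p p h; rewrite ei.
have nxt p q : r p q -> exists z, r q z && (z != p).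
  move=> rpq; apply/existsP; apply: contraT; rewrite negb_exists => /forallP none.
  have := kd q; rewrite (bigD1 p) //= big1 ?addr0 => [kqp|z zp].
    by rewrite /r ks kqp eqxx in rpq.
  by apply/eqP; have := none z; rewrite zp andbT negbK.
have [c [/andP[cc uc] c2]] := no_leaf_cycle ri kpq0 nxt.
have cyc : ucycle e c by rewrite /ucycle uc andbT; apply: sub_cycle cc => p q; exact: re.
apply: (@leq_trans (2 * size c)); first by rewrite leq_mul2l /= hg.
have -> : #|[set u : T * T | (k u.1 u.2 != 0)%R]| = \sum_p #|[set q | r p q]|.
  rewrite -sum1_card (eq_bigr (fun p => \sum_(q | r p q) 1)).
    by rewrite pair_big_dep /=; apply: eq_bigl => -[p q]; rewrite !inE.
  by move=> p _; rewrite -sum1_card; apply: eq_bigl => q; rewrite inE.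
rewrite -(card_uniqP uc) mulnC -sum_nat_const [X in _ <= X](bigID (mem c)) /=.
apply: leq_trans (leq_addr _ _); apply: leq_sum => p pc.
have rpq := next_cycle cc pc; set q := next c p in rpq.
have [|z /andP[rpz zq]] := nxt q p; first by rewrite rs.
apply: (@leq_trans #|[set q; z]|); first by rewrite cards2 eq_sym zq.
by apply: subset_leq_card; apply/subsetP => y; rewrite !inE => /orP[]/eqP ->.
Qed.

(** * The 2-core and the trees hanging from it *)

Section Core.
Variables (T : finType) (e : rel T).
Hypotheses (es : symmetric e) (ei : irreflexive e).

Definition deg_in (A : {set T}) (x : T) : nat := #|[set y in A | e x y]|.

Definition min_deg2 (A : {set T}) : bool := [forall x in A, 1 < deg_in A x].

Definition core : {set T} := \bigcup_(A : {set T} | min_deg2 A) A.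

Lemma deg_in_sub (A B : {set T}) x : A \subset B -> deg_in A x <= deg_in B x.
Proof.
move=> /subsetP AB; apply: subset_leq_card; apply/subsetP => y.
by rewrite !inE => /andP[/AB -> ->].
Qed.

Lemma core_sup (A : {set T}) : min_deg2 A -> A \subset core.
Proof. by move=> hA; apply: bigcup_sup. Qed.

Lemma core_deg x : x \in core -> 1 < deg_in core x.
Proof.
case/bigcupP => A hA xA; apply: leq_trans (deg_in_sub x (core_sup hA)).
by move/forallP: hA => /(_ x); rewrite xA.
Qed.

Definition child_of (par : T -> T) (dep : T -> nat) (rt : T -> T) (x y : T) : Prop :=
  [/\ par x = y, dep x = (dep y).+1, rt x = rt y & x \notin core].

(* Outside the core, the graph is a forest of trees hanging from core vertices,
   plus tree components. [dep] and [rt] are depth and root in these trees; the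
   root of a tree component is its own parent. *)
Lemma hanging_trees : exists (par : T -> T) (dep : T -> nat) (rt : T -> T),
  [/\ forall x, x \in core -> dep x = 0 /\ rt x = x,
      forall x y, e x y -> ~~ ((x \in core) && (y \in core)) ->
        child_of par dep rt x y \/ child_of par dep rt y x
    & forall x, x \notin core ->
        e x (par x) /\ child_of par dep rt x (par x) \/ [/\ par x = x, dep x = 0 & rt x = x]].
Proof.
suff main : forall A : {set T}, core \subset A ->
    exists (par : T -> T) (dep : T -> nat) (rt : T -> T),
    [/\ forall x, x \in core -> dep x = 0 /\ rt x = x,
        forall x y, x \in A -> y \in A -> e x y -> ~~ ((x \in core) && (y \in core)) ->
          child_of par dep rt x y \/ child_of par dep rt y x
      & forall x, x \in A -> x \notin core ->
          par x \in A /\ (e x (par x) /\ child_of par dep rt x (par x) \/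
            [/\ par x = x, dep x = 0 & rt x = x])].
  have [par [dep [rt [h1 h2 h3]]]] := main setT (subsetT _).
  exists par, dep, rt; split=> // [x y|x nx].
    by apply: h2; rewrite inE.
  by have [] := h3 x (in_setT x) nx.
(* If [A] is not inside the core, some vertex has at most one neighbour in [A]. It lies outside the
   core, is removed, and returns as a leaf below that neighbour, or as a new root. *)
move=> A; have [n] := ubnP #|A :\: core|; elim: n A => // n IH A hn cA.
have [Ac|/subsetPn[x0 x0A nx0]] := boolP (A \subset core).
  exists id, (fun _ => 0), id; split=> // [x y /(subsetP Ac) -> /(subsetP Ac) -> //|x /(subsetP Ac) ->].
  by [].
have : ~~ min_deg2 A by apply: contra nx0 => /core_sup/subsetP; apply.
rewrite negb_forall => /existsP[x]; rewrite negb_imply => /andP[xA]; rewrite -leqNgt => dx.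
have nx : x \notin core.
  apply: contraL dx => /core_deg h; rewrite -ltnNge; exact: leq_trans h (deg_in_sub x cA).
have cA' : core \subset A :\ x.
  apply/subsetP => y yc; rewrite !inE (subsetP cA y yc) andbT.
  by apply: contraNneq nx => <-.
have [|par [dep [rt [h1 h2 h3]]]] := IH (A :\ x) _ cA'.
  rewrite -ltnS; apply: leq_trans hn; rewrite ltnS [X in _ < X](cardsD1 x) !inE nx xA /= add1n ltnS.
  by apply: subset_leq_card; apply/subsetP => y; rewrite !inE => /and3P[-> -> ->].
have uniq_nbr y z : y \in A -> e x y -> z \in A -> e x z -> y = z.
  move=> yA xy zA xz; apply/eqP; apply: contraLR dx => yz; rewrite -ltnNge.
  apply: (@leq_trans #|[set y; z]|); first by rewrite cards2 yz.
  apply: subset_leq_card; apply/subsetP => w.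
  by rewrite !inE => /orP[]/eqP ->; rewrite ?yA ?zA ?xy ?xz.
pose px := odflt x [pick y in A | e x y].
pose dx' := if [pick y in A | e x y] is Some y then (dep y).+1 else 0.
pose rx := if [pick y in A | e x y] is Some y then rt y else x.
pose upd (U : Type) (f : T -> U) (v : U) z := if z == x then v else f z.
have updx U f v : @upd U f v x = v by rewrite /upd eqxx.
have updn U f v z : z != x -> @upd U f v z = f z by rewrite /upd => /negPf ->.
have leafn y z : y != x -> z != x -> child_of par dep rt y z ->
    child_of (upd _ par px) (upd _ dep dx') (upd _ rt rx) y z.
  by move=> yx zx [a b c d]; split; rewrite ?updn.
have leafx y : y \in A -> e x y -> child_of (upd _ par px) (upd _ dep dx') (upd _ rt rx) x y.
  move=> yA xy; have yx : y != x by apply: contraTneq xy => ->; rewrite ei.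
  rewrite /child_of !updx !(updn _ _ _ y) // /px /dx' /rx.
  case: pickP => [z /andP[zA xz]|none].
    by rewrite (uniq_nbr z y).
  by have := none y; rewrite /= yA xy.
exists (upd _ par px), (upd _ dep dx'), (upd _ rt rx); split.
- move=> y yc; have yx : y != x by apply: contraNneq nx => <-.
  by rewrite !updn //; exact: h1.
- move=> y z yA zA yz nyz.
  have [yx|yx] := eqVneq y x; first by left; rewrite yx; apply: leafx; rewrite // -yx.
  have [zx|zx] := eqVneq z x; first by right; rewrite zx; apply: leafx; rewrite // -zx es.
  have := h2 y z; rewrite !inE yx zx yA zA => /(_ isT isT yz nyz)[l|l]; [left|right]; exact: leafn.
- move=> y yA nyc; have [->|yx] := eqVneq y x.
    rewrite updx; have [[z zE]|none] : (exists z, [pick y in A | e x y] = Some z) \/ [pick y in A | e x y] = None.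
      by case: [pick y in A | e x y] => [z|]; [left; exists z|right].
    + have : z \in A /\ e x z by move: zE; case: pickP => // w /andP[? ?] [<-].
      move=> [zA xz]; have l := leafx z zA xz; have pz : px = z by rewrite /px zE.
      by rewrite -pz in zA xz l; split=> //; left.
    + by rewrite /px none /=; split=> //; right; rewrite !updx /dx' /rx none.
  have [] := h3 y; rewrite ?inE ?yx // => /andP[px' pA] h.
  rewrite updn //; split=> //; case: h => [[a b]|[a b c]]; [left|right].
    by split=> //; exact: leafn.
  by rewrite !updn.
Qed.
End Core.

(** * Long threads in the core *)

Section Thread.
Variables (T : finType) (e : rel T) (g L : nat).
Hypotheses (es : symmetric e) (ei : irreflexive e).
Hypothesis hg : forall c, ucycle e c -> 2 < size c -> g <= size c.
Let C := core e.
Let ec x y := [&& e x y, x \in C & y \in C].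
Hypotheses (C0 : C != set0) (L0 : 0 < L) (gL : 6 * L <= g).
Hypothesis ecd : has_dual ec.

(** Successor of a dart in a walk that never turns back. The default never arises on darts of the
    core, whose vertices have inner degree at least 2. *)
Let nx (u : T * T) := (u.2, odflt u.1 [pick z | ec u.2 z && (z != u.1)]).

Let ec_sym : symmetric ec.
Proof. by move=> x y; rewrite /ec es [(x \in C) && _]andbC. Qed.

Let ec_irrefl : irreflexive ec.
Proof. by move=> x; rewrite /ec ei. Qed.

Let degE x : x \in C -> deg_in e C x = #|[set y | ec x y]|.
Proof. by move=> xC; apply: eq_card => y; rewrite !inE /ec xC /= andbC. Qed.

Let nxP u : ec u.1 u.2 -> ec (nx u).1 (nx u).2 && ((nx u).2 != u.1).
Proof.
case: u => x y /= xy; rewrite /nx /=; case: pickP => //= none.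
have /and3P[_ _ yC] := xy; have := core_deg yC; rewrite -/C degE // (cardsD1 x) inE ec_sym xy.
rewrite ltnS => /card_gt0P[z]; rewrite !inE => /andP[zx yz].
by have := none z; rewrite yz zx.
Qed.

Let iter_ec u i : ec u.1 u.2 -> ec (iter i nx u).1 (iter i nx u).2.
Proof. by move=> eu; elim: i => //= i /nxP/andP[]. Qed.

Let deg2_nbrs x a b : deg_in e C x <= 2 -> ec x a -> ec x b -> a != b ->
  forall y, ec x y -> y = a \/ y = b.
Proof.
move=> d2 xa xb ab y xy; have /and3P[_ xC _] := xy.
have /eqP E : [set a; b] == [set z | ec x z].
  rewrite eqEcard cards2 ab -degE // d2 andbT.
  by apply/subsetP => z; rewrite !inE => /orP[]/eqP ->.
have : y \in [set a; b] by rewrite E inE.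
by rewrite !inE => /orP[]/eqP; [left|right].
Qed.

Let long_dart : exists u, ec u.1 u.2 /\ forall i, i < L -> deg_in e C (iter i nx u).2 <= 2.
Proof.
apply: contrapT => noway.
pose D := [set u : T * T | ec u.1 u.2].
pose stop (u : T * T) i := (i < L) && (2 < deg_in e C (iter i nx u).2).
have stopE u : u \in D -> exists i, stop u i.
  rewrite inE => eu; apply: contrapT => none; apply: noway; exists u; split=> // i iL.
  by rewrite leqNgt; apply/negP => h; apply: none; exists i; rewrite /stop iL.
pose st u := if pselect (exists i, stop u i) is left h then ex_minn h else 0.
have stP u : u \in D -> stop u (st u) /\ forall i, i < st u -> deg_in e C (iter i nx u).2 <= 2.
  move=> /stopE h; rewrite /st; case: pselect => // h'; case: ex_minnP => m mP mmin; split=> // i im.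
  rewrite leqNgt; apply/negP => d; have /andP[mL _] := mP.
  by have := mmin i; rewrite /stop d (ltn_trans im mL) => /(_ isT); rewrite leqNgt im.
pose Term := [set u in D | 2 < deg_in e C u.2].
(* Through vertices of degree 2 the walk can be traced back uniquely. So a dart is determined by the
   first dart on its walk that ends at degree at least 3 and the number of steps to it, fewer than
   [L]. *)
have inj i u u' : u \in D -> u' \in D -> (forall j, j < i -> deg_in e C (iter j nx u).2 <= 2) ->
    (forall j, j < i -> deg_in e C (iter j nx u').2 <= 2) -> iter i nx u = iter i nx u' -> u = u'.
  elim: i => //= i IH uD uD' h h' E; apply: IH => //.
  - by move=> j ji; apply/h/leqW.
  - by move=> j ji; apply/h'/leqW.
  have eu : ec (iter i nx u).1 (iter i nx u).2 by apply: iter_ec; rewrite inE in uD.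
  have eu' : ec (iter i nx u').1 (iter i nx u').2 by apply: iter_ec; rewrite inE in uD'.
  move: (h i (leqnn _)) eu eu' E; case: (iter i nx u) (iter i nx u') => [x y] [x' y'] /= d2 xy xy'.
  have /andP[h1 n1] := @nxP (x, y) xy; have /andP[h2 n2] := @nxP (x', y') xy'.
  move=> E; have yy : y = y' by have := congr1 fst E.
  move: E h1 n1 h2 n2 => ->; rewrite -{}yy in xy' *; rewrite /=.
  move: (odflt _ _) => z h1 n1 h2 n2.
  have yx : ec y x by rewrite ec_sym.
  have zx : z != x by [].
  by have [|E|->] := deg2_nbrs d2 h1 yx zx (y := x'); rewrite ?(ec_sym y) //; rewrite E eqxx in n2.
have cardD : #|D| <= L * #|Term|.
  pose F u := (iter (st u) nx u, inord (st u) : 'I_L.-1.+1).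
  rewrite -[L](prednK L0) -[X in X * _]card_ord mulnC -cardsT -cardsX.
  rewrite -(card_in_imset (f := F) (D := D)); last first.
    move=> u u' uD uD' [E /(congr1 val)] /=.
    have [/andP[sL _] hs] := stP u uD; have [/andP[sL' _] hs'] := stP u' uD'.
    rewrite !inordK ?prednK // => ss; rewrite -ss in E hs'.
    exact: (inj (st u)).
  apply: subset_leq_card; apply/subsetP => w /imsetP[u uD ->].
  rewrite !inE andbT; have [/andP[_ ->] _] := stP u uD; rewrite andbT.
  by apply: iter_ec; rewrite inE in uD.
have cE (P : pred T) : #|[set u in D | P u.2]| = \sum_(y in C | P y) deg_in e C y.
  rewrite -sum1_card (eq_bigr (fun y => \sum_(x | ec x y) 1)); last first.
    by move=> y /andP[yC _]; rewrite degE // -sum1_card; apply: eq_bigl => x; rewrite inE ec_sym.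
  rewrite pair_big_dep /= (reindex (fun u : T * T => (u.2, u.1))) /=; last first.
    by exists (fun u => (u.2, u.1)); case.
  apply: eq_bigl => -[x y]; rewrite !inE /=.
  by case xy : (ec y x); rewrite ?andbF //=; have /and3P[_ _ ->] := xy; rewrite andbT.
have DE : #|D| = \sum_(y in C) deg_in e C y.
  transitivity (\sum_(y in C | xpredT y) deg_in e C y); last by apply: eq_bigl => y; rewrite andbT.
  by rewrite -cE; apply: eq_card => u; rewrite !inE andbT.
have deg2 y : y \in C -> 1 < deg_in e C y by exact: core_deg.
(* Vertex by vertex: a degree [d >= 3] satisfies [d <= 3 * (d - 2)], and vertices of degree 2
   contribute nothing. *)
have TE : #|Term| + 3 * (2 * #|C|) <= 3 * #|D|.
  rewrite [#|Term|](cE (fun y => 2 < deg_in e C y)) DE big_mkcondr /= mulnA mulnC -sum_nat_const -big_split /= big_distrr /=.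
  by apply: leq_sum => y /deg2 dy; case: ifP => dy2; lia.
have := @girth_euler T ec C g ec_sym ec_irrefl ecd _ C0 _.
rewrite -/D => eul.
have {}eul : (#|D| + 2 - 2 * #|C|) * g <= 2 * #|D|.
  apply: eul => [x y /and3P[] //|c /andP[cc uc] c2]; apply: hg => //.
  by rewrite /ucycle uc andbT; apply: sub_cycle cc => x y /and3P[].
have Cpos : 0 < #|C| by rewrite card_gt0.
have D2 : 2 * #|C| <= #|D|.
  by rewrite DE mulnC -sum_nat_const; apply: leq_sum => y /deg2.
have h1 : (#|D| + 2 - 2 * #|C|) * (6 * L) <= 2 * #|D|.
  by apply: leq_trans eul; rewrite leq_mul2l gL orbT.
move: cardD TE D2 h1; move: #|D| #|Term| #|C| => dd tt cc; nia.
Qed.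

(* Were every dart of the core to meet a vertex of degree at least 3 within [L]
   steps, the core would have at most [3 * L] times as many edges as its
   cyclomatic number minus one, against Euler's bound for girth [6 * L]. *)
Lemma core_thread : exists v : nat -> T,
  [/\ forall i, i <= L.+1 -> v i \in C,
      forall i, i < L.+1 -> e (v i) (v i.+1),
      forall i j, i <= L.+1 -> j <= L.+1 -> v i = v j -> i = j
    & forall i y, 0 < i -> i < L.+1 -> y \in C -> e (v i) y -> y = v i.-1 \/ y = v i.+1].
Proof.
have [u [eu hu]] := long_dart.
pose v i := (iter i nx u).1.
have ev i : ec (v i) (v i.+1) by apply: iter_ec.
have nb i : v i.+2 != v i by have /andP[_] := nxP (iter_ec i eu).
exists v; split.
- by move=> i _; have /and3P[] := ev i.
- by move=> i _; have /and3P[] := ev i.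
- move=> i j iL jL vij.
  have half a b : b <= L.+1 -> a < b -> v a = v b -> False.
    move=> bL ab vab.
    have [|||c [c1 c2 c3]] := @nb_walk_cycle T e ei v L.+1 _ _ _.
    + by move=> l _; have /and3P[] := ev l.
    + by move=> l _; exact: nb.
    + by exists a, b.
    have := hg c1 c2; lia.
  by case: (ltngtP i j) => // ij; [case: (half i j)|case: (half j i)].
- move=> [//|i] y _ iL yC evy /=.
  have xy : ec (v i.+1) y by rewrite /ec evy yC andbT; have /and3P[] := ev i.+1.
  apply: (deg2_nbrs _ _ (ev i.+1) _ xy); first exact: hu.
    by rewrite ec_sym ev.
  by rewrite eq_sym nb.
Qed.

End Thread.

(** * Greedy colouring *)

(** Vertices outside [P] are coloured by increasing [key]. Ties count as earlier on both sides, so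
    their order is immaterial. *)
Lemma greedy_colouring (T : finType) (cf : rel T) (P : {set T}) (key : T -> nat) (n : nat)
    (c0 : T -> nat) :
  symmetric cf -> (forall x, x \in P -> c0 x < n) ->
  (forall x y, x \in P -> y \in P -> x != y -> cf x y -> c0 x != c0 y) ->
  (forall x, x \notin P ->
     #|[set y | [&& y != x, cf x y & (y \in P) || (key y <= key x)]]| < n) ->
  exists c : T -> nat, (forall x, c x < n) /\ forall x y, x != y -> cf x y -> c x != c y.
Proof.
move=> cfs c0n c0P few.
suff main (A : {set T}) : P \subset A -> exists c : T -> nat,
    [/\ forall x, x \in A -> c x < n & {in A &, forall x y, x != y -> cf x y -> c x != c y}].
  have [c [h1 h2]] := main setT (subsetT _).
  by exists c; split=> [x|x y]; [apply: h1|apply: h2]; rewrite inE.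
have [m] := ubnP #|A :\: P|; elim: m A => // m IH A hm PA.
have [E|/set0Pn[x0 x0A]] := eqVneq (A :\: P) finset.set0.
  have AP : A \subset P by rewrite -setD_eq0 E.
  by exists c0; split=> [x /(subsetP AP)|x y /(subsetP AP) h1 /(subsetP AP) h2]; [exact: c0n|exact: c0P].
have [x xA xmax] := arg_maxnP key x0A.
have {}xA : x \in A :\: P := xA.
have := xA; rewrite inE => /andP[nxP xA'].
have [||c [c1 c2]] := IH (A :\ x).
- rewrite -ltnS; apply: leq_trans hm; rewrite ltnS [X in _ < X](cardsD1 x) xA add1n ltnS.
  by apply: subset_leq_card; apply/subsetP => y; rewrite !inE => /and3P[-> -> ->].
- apply/subsetP => y yP; rewrite !inE (subsetP PA y yP) andbT.
  by apply: contraNneq nxP => <-.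
pose bad := [set y in A :\ x | cf x y].
have badn : #|bad| < n.
  apply: leq_ltn_trans (few x nxP); apply: subset_leq_card; apply/subsetP => y.
  rewrite !inE => /andP[/andP[-> yA] ->] /=; case: (boolP (y \in P)) => //= nyP.
  have h : y \in A :\: P by rewrite inE nyP yA.
  exact: xmax h.
have [i iN ni] : exists2 i, i < n & i \notin [seq c y | y in bad].
  have [/allP sub|/allPn[i]] := boolP (all (mem [seq c y | y in bad]) (iota 0 n)).
    have := uniq_leq_size (iota_uniq 0 n) sub.
    by rewrite size_iota size_map -cardE leqNgt badn.
  by rewrite mem_iota => iN ni; exists i.
have free y : y \in A -> y != x -> cf x y -> c y != i.
  move=> yA yx xy; apply: contraNneq ni => <-.
  by apply/imageP; exists y => //; rewrite !inE yx yA.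
exists (fun y => if y == x then i else c y); split=> [y yA|y z yA zA yz cyz].
  by case: eqP => // /eqP yx; apply: c1; rewrite !inE yx.
case: (eqVneq y x) yz cyz => [->|yx] yz cyz; case: (eqVneq z x) => [zx|zx].
- by rewrite zx eqxx in yz.
- by rewrite eq_sym free.
- by rewrite free // cfs -zx.
- by apply: c2; rewrite // !inE ?yx ?zx.
Qed.

(** * Balls in graphs of bounded degree *)

Section Balls.
Variables (T : finType) (e : rel T) (a : nat).
Hypothesis es : symmetric e.
Hypothesis deg_le : forall x, #|[set y | e x y]| <= a.+1.

Fixpoint gball (n : nat) (x : T) : {set T} :=
  if n is n'.+1 then gball n' x :|: \bigcup_(y | e x y) gball n' y else [set x].

Lemma gballP n x y : reflect (exists s, [/\ path e x s, last x s = y & size s <= n]) (y \in gball n x).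
Proof.
apply: (iffP idP) => [|[s []]].
  elim: n x => [|n IH] x /=; first by rewrite inE => /eqP ->; exists [::].
  rewrite inE => /orP[/IH[s [s1 s2 s3]]|/bigcupP[z xz /IH[s [s1 s2 s3]]]].
    by exists s; split=> //; exact: leqW.
  by exists (z :: s); split; rewrite //= ?xz.
elim: n x s => [|n IH] x [|z s] //=; rewrite ?inE; first by move=> _ ->.
  by move=> _ xy _; apply/orP; left; apply: (IH x [::]).
move=> /andP[xz zs] ls sn; apply/orP; right; apply/bigcupP; exists z => //; exact: IH ls sn.
Qed.

Lemma gball_uniqP n x y : y \in gball n x ->
  exists s, [/\ path e x s, uniq (x :: s), last x s = y & size s <= n].
Proof.
move=> /gballP[s [s1 <- s3]]; case: (shortenP s1) => s' s'1 s'2 s'3.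
exists s'; split=> //; apply: leq_trans s3.
exact: (uniq_leq_size (subseq_uniq (subseq_cons s' x) s'2)).
Qed.

Lemma gball_sym n x y : (y \in gball n x) = (x \in gball n y).
Proof.
suff h u w : w \in gball n u -> u \in gball n w by apply/idP/idP; exact: h.
move=> /gballP[s [s1 <- s3]]; apply/gballP; exists (rev (belast u s)); split.
- by rewrite -(eq_path (fun z w => es w z)) rev_path.
- by case: s {s1 s3} => //= z s; rewrite rev_cons last_rcons.
- by rewrite size_rev size_belast.
Qed.

Lemma gball_trans m n x y z : y \in gball m x -> z \in gball n y -> z \in gball (m + n) x.
Proof.
move=> /gballP[s [s1 <- s3]] /gballP[r [r1 <- r3]]; apply/gballP; exists (s ++ r).
by rewrite cat_path s1 r1 last_cat size_cat leq_add.
Qed.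

(* endpoints of the non-backtracking walks that traverse the edge [p -- v] and
   then make [n] more steps *)
Fixpoint ahead (n : nat) (p v : T) : {set T} :=
  if n is n'.+1 then \bigcup_(w | e v w && (w != p)) ahead n' v w else [set v].

Lemma card_bigcup_le (I S : finType) (P : pred I) (F : I -> {set S}) :
  #|\bigcup_(i | P i) F i| <= \sum_(i | P i) #|F i|.
Proof.
elim/big_rec2: _ => [|i n A _ IH]; first by rewrite cards0.
by apply: leq_trans (leq_card_setU _ _) _; rewrite leq_add2l.
Qed.

Lemma card_ahead n p v : e p v -> #|ahead n p v| <= a ^ n.
Proof.
elim: n p v => [|n IH] p v pv /=; first by rewrite cards1.
apply: leq_trans (card_bigcup_le _ _) _.
apply: (@leq_trans (\sum_(w | e v w && (w != p)) a ^ n)).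
  by apply: leq_sum => w /andP[vw _]; exact: IH.
rewrite sum_nat_const expnS leq_mul2r; apply/orP; right; rewrite -ltnS.
apply: leq_trans (deg_le v); rewrite (cardsD1 p) inE es pv add1n ltnS.
by apply: subset_leq_card; apply/subsetP => w; rewrite !inE => /andP[-> ->].
Qed.

Lemma path_ahead p v s : path e v s -> uniq [:: p, v & s] -> last v s \in ahead (size s) p v.
Proof.
elim: s p v => [|w s IH] p v /=; first by rewrite inE.
move=> /andP[vw ws] /and4P[h1 h2 h3 h4]; apply/bigcupP; exists w.
  by rewrite vw /=; apply: contraNneq h1 => ->; rewrite !inE eqxx orbT.
by apply: IH; rewrite /= ?ws ?h2 ?h3.
Qed.

(** The ball of radius [n] in the [a.+1]-regular tree, summed by spheres. *)
Definition ball_size (n : nat) : nat := 1 + \sum_(i < n) a.+1 * a ^ i.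

Lemma ball_sizeS n : ball_size n.+1 = ball_size n + a.+1 * a ^ n.
Proof. by rewrite /ball_size big_ord_recr /= addnA. Qed.

Lemma card_ball n u : #|gball n u| <= ball_size n.
Proof.
pose layer i := \bigcup_(w | e u w) ahead i u w.
have cov : gball n u \subset [set u] :|: \bigcup_(i < n) layer i.
  apply/subsetP => y /gball_uniqP[[|w s] [s1 s2 <- s4]]; first by rewrite !inE eqxx.
  rewrite inE; apply/orP; right; apply/bigcupP; exists (Ordinal s4) => //=.
  by move: s1 => /andP[uw ws]; apply/bigcupP; exists w => //; apply: path_ahead.
apply: leq_trans (subset_leq_card cov) _; apply: leq_trans (leq_card_setU _ _) _.
rewrite cards1 leq_add2l; apply: leq_trans (card_bigcup_le _ _) _; apply: leq_sum => i _.
apply: leq_trans (card_bigcup_le _ _) _.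
apply: (@leq_trans (\sum_(w | e u w) a ^ i)); first by apply: leq_sum => w; exact: card_ahead.
rewrite sum_nat_const leq_mul2r; apply/orP; right; apply: leq_trans (deg_le u).
by apply: subset_leq_card; apply/subsetP => w; rewrite !inE.
Qed.

Definition ball_colourable (t n : nat) : Prop :=
  exists c : T -> nat, (forall x, c x < n) /\
    forall x y, x != y -> y \in gball t x -> c x != c y.

Section Climb.
Variable par : T -> T.

(* A path follows [par] for [k] steps, or it leaves the ancestor line of [x] at
   [iter l par x] with [l < k] without turning back. *)
Lemma climb k x s : path e x s -> uniq (x :: s) ->
  (exists s', [/\ path e (iter k par x) s', last (iter k par x) s' = last x s & size s' + k = size s]) \/
  exists l, let w := iter l par x in let s2 := drop l s in
    [/\ l < k, l <= size s, path e w s2 /\ uniq (w :: s2), last w s2 = last x s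
      & forall z s3, s2 = z :: s3 -> z != par w /\ (0 < l -> z != iter l.-1 par x)].
Proof.
elim: k x s => [|k IH] x s xs ux; first by left; exists s; rewrite addn0.
case: s xs ux => [|z s] xs ux; first by right; exists 0.
have [zx|nzx] := eqVneq z (par x); last first.
  by right; exists 0; split=> // z' s' [<- _].
have /andP[xz zs] : e x z && path e z s := xs.
have /andP[nx uz] : (x \notin z :: s) && uniq (z :: s) := ux.
have [[s' [h1 h2 h3]]|[l [h1 h2 h3 h4 h5]]] := IH z s zs uz.
  by left; exists s'; rewrite iterSr -zx; split=> //; rewrite addnS h3.
right; exists l.+1; rewrite iterSr -zx; split=> //.
move=> z' s3 E; have [h6 h7] := h5 _ _ E; split=> // _; case: l E h1 h2 h3 h4 h5 h6 h7 => [|l] E h1 h2 h3 h4 h5 h6 h7.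
  change (z' != x); apply: contraNneq nx => <-; move: E => /=; rewrite drop0 => ->.
  by rewrite !inE eqxx orbT.
change (z' != iter l.+1 par x); rewrite iterSr -zx; exact: h7.
Qed.

End Climb.
End Balls.

(** * Colouring forests *)

Section Forest.
Variables (T : finType) (e : rel T) (a : nat).
Hypothesis es : symmetric e.
Hypothesis deg_le : forall x, #|[set y | e x y]| <= a.+1.

(** A path that does not begin with the parent can never climb later: at each vertex the parent is
    the one it has just come from. *)
Lemma descend (Q : pred T) (par : T -> T) (lev : T -> nat) :
  (forall x y, Q x -> e x y -> y = par x \/ [/\ Q y, par y = x & lev y = (lev x).+1]) ->
  forall s x, Q x -> path e x s -> uniq (x :: s) -> (forall z s', s = z :: s' -> z != par x) ->
    Q (last x s) /\ lev (last x s) = lev x + size s.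
Proof.
move=> step; elim=> [|z s IH] x Qx; first by rewrite addn0.
move=> /= /andP[xz zs] /andP[nx uz] nz.
have [zp|[Qz pz lz]] := step x z Qx xz; first by have := nz _ _ erefl; rewrite zp eqxx.
have [|h1 h2] := IH z Qz zs uz _; last by rewrite h2 lz addnS.
by move=> w s' sE; rewrite pz; apply: contraNneq nx => <-; rewrite sE !inE eqxx orbT.
Qed.

Lemma iter_ball (par : T -> T) j w :
  (forall i, i < j -> let z := iter i par w in par z = z \/ e z (par z)) ->
  iter j par w \in gball e j w.
Proof.
elim: j => [|j IH] h; first by rewrite inE.
rewrite -addn1; apply: (gball_trans (y := iter j par w)).
  by apply: IH => i ij; apply: h; exact: leqW.
apply/gballP; rewrite addn1 iterS; have [E|E] := h j (leqnn _).
  by exists [::].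
by exists [:: par (iter j par w)]; rewrite /= E.
Qed.

Lemma forest_colouring (par : T -> T) (dep : T -> nat) k :
  (forall x, par x = x \/ e x (par x)) ->
  (forall x y, e x y -> y = par x \/ par y = x /\ dep y = (dep x).+1) ->
  (forall x, dep x <= (dep (par x)).+1) ->
  ball_colourable e k.*2 (ball_size a k).
Proof.
move=> par_step nbr dep_par.
apply: (@greedy_colouring _ (fun x y => y \in gball e k.*2 x) finset.set0 dep _ (fun _ => 0)).
- by move=> x y; rewrite gball_sym.
- by move=> x; rewrite inE.
- by move=> x y; rewrite inE.
move=> x _; pose u := iter k par x.
have xu : x \in gball e k u by rewrite gball_sym //; apply: iter_ball.
apply: leq_trans (card_ball es deg_le k u).
apply: proper_card; apply/properP; split; last first.
  by exists x => //; rewrite !inE eqxx.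
apply/subsetP => y; rewrite !inE => /and3P[_ /gball_uniqP[s [xs us sy sk]] dyx].
have [[s' [h1 h2 h3]]|[l [lk ls [ws uw] wy turn]]] := @climb _ e par k x s xs us.
  by apply/gballP; exists s'; rewrite h2 -sy; split=> //; lia.
set w := iter l par x in ws uw wy turn.
have depw : dep x <= dep w + l.
  rewrite /w; elim: (l) => [|i IH] /=; first by rewrite addn0.
  by apply: leq_trans IH _; rewrite addnS -addSn leq_add2r.
have [_ dy] := @descend xpredT par dep (fun x y _ xy =>
    match nbr x y xy with or_introl h => or_introl h | or_intror (conj h1 h2) => or_intror (And3 isT h1 h2) end)
    _ w isT ws uw (fun z s' E => (turn z s' E).1).
rewrite wy sy in dy.
(* As [y] is no deeper than [x], the path descends from [w] at most the [l] steps it climbed, so it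
   stays within [(k - l) + l] of [u]. *)
have uE : u = iter (k - l) par w by rewrite /w -iterD subnK // ltnW.
have -> : k = (k - l) + l by rewrite subnK // ltnW.
apply: (gball_trans (y := w)).
  by rewrite gball_sym // uE; apply: iter_ball.
apply/gballP; exists (drop l s); rewrite wy sy; split=> //; lia.
Qed.

End Forest.

Ltac arith :=
  repeat match goal with
  | H : is_true (leq _ _) |- _ => revert H
  | H : is_true (andb (leq _ _) (leq _ _)) |- _ => revert H
  | H : @eq nat _ _ |- _ => revert H

  end; clear; intros; lia.

(* This is where maximum degree at least 4 is needed. *)
Lemma geometric_bound a h m : 2 < a -> a ^ h + 2 * (\sum_(i < m) a ^ (h + i)) <= a ^ (h + m).
Proof.
move=> a3; elim: m => [|m IH]; first by rewrite big_ord0 addn0 muln0 addn0.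
rewrite big_ord_recr /= mulnDr addnA addnS expnS.
apply: (@leq_trans (3 * a ^ (h + m))); last by rewrite leq_mul2r a3 orbT.
by rewrite (mulnDl 1 2) mul1n leq_add2r.
Qed.

(** * Recolouring a thread *)

Section ThreadColouring.
Variables (T : finType) (e : rel T) (a k ell : nat).
Hypothesis es : symmetric e.
Hypothesis deg_le : forall x, #|[set y | e x y]| <= a.+1.
Hypotheses (a3 : 2 < a) (k0 : 0 < k) (ellE : ell = (4 * k).+1).
(** [v] is the spine, [M] its interior together with the trees hanging there. In [M], [idx] is the
    index of the spine vertex carrying the tree, [dep] the height above it and [par0] the parent in
    the tree. *)
Variables (v : nat -> T) (M : pred T) (idx dep : T -> nat) (par0 : T -> T).
Hypothesis spine_in : forall j, 0 < j -> j < ell -> [/\ M (v j), idx (v j) = j & dep (v j) = 0].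
Hypothesis idx_itv : forall x, M x -> 0 < idx x < ell.
Hypothesis dep0 : forall x, M x -> dep x = 0 -> x = v (idx x).
Hypothesis nbr : forall x y, M x -> e x y ->
  [\/ [/\ 0 < dep x, y = par0 x, M y, idx y = idx x & dep x = (dep y).+1],
      [/\ M y, par0 y = x, idx y = idx x & dep y = (dep x).+1]
    | dep x = 0 /\ (y = v (idx x).-1 \/ y = v (idx x).+1)].
Hypothesis par0P : forall x, M x -> 0 < dep x ->
  [/\ e x (par0 x), M (par0 x), idx (par0 x) = idx x & dep x = (dep (par0 x)).+1].
Hypothesis ends_out : ~~ M (v 0) /\ ~~ M (v ell).
Hypothesis spine_edge : forall j, j < ell -> e (v j) (v j.+1).

(* the distance from [x] to the part of the graph outside the thread *)
Let f x := if M x then minn (idx x) (ell - idx x) + dep x else 0.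
Let P := [set x | f x <= k].
(** Parent after rooting the thread with its trees at [v 0]. *)
Let par x := if 0 < dep x then par0 x else v (idx x).-1.
(** Lexicographic: distance from [v 0], then larger [idx], that is, smaller height, first. The
    factor [ell.+1] exceeds any second entry. *)
Let key x := (idx x + dep x) * ell.+1 + (ell - idx x).

Let f_spine j : j <= ell -> f (v j) = minn j (ell - j).
Proof.
move=> jl; have [->|j1] := posnP j; first by rewrite /f (negPf ends_out.1) min0n.
have [->|j2] := eqVneq j ell; first by rewrite /f (negPf ends_out.2) subnn minn0.
have [||h1 h2 h3] := spine_in (j := j); [by []|by rewrite ltn_neqAle j2|].
by rewrite /f h1 h2 h3 addn0.
Qed.

Let f_lip x y : e x y -> f x <= (f y).+1.
Proof.
move=> xy; rewrite {1}/f; case: (boolP (M x)) => // Mx.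
have := idx_itv Mx.
case: (nbr Mx xy) => [[_ _ My iy dx]|[My _ iy dy]|[dx [->|->]]] hx.
- by rewrite /f My iy dx; arith.
- by rewrite /f My iy dy; arith.
- by rewrite f_spine ?dx; arith.
- by rewrite f_spine ?dx; arith.
Qed.

Let f_path x s : path e x s -> f x <= f (last x s) + size s /\ f (last x s) <= f x + size s.
Proof.
elim: s x => [|z s IH] x /=; first by rewrite addn0.
move=> /andP[xz /IH[h1 h2]]; have := f_lip xz.
by have := f_lip (x := z) (y := x); rewrite es => /(_ xz); arith.
Qed.

Let mid x y := (x == v k.*2) && (y == v k.*2.+1).
Definition cut_edge x y := e x y && ~~ (mid x y || mid y x).

Let cut_path x s : path e x s -> path cut_edge x s \/
  exists p q, [/\ f p >= k.*2, f q >= k.*2 & exists s1 s2,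
    [/\ path e x s1, last x s1 = p, path e q s2, last q s2 = last x s & size s = (size s1 + size s2).+1]].
Proof.
elim: s x => [|z s IH] x; first by left.
move=> /= /andP[xz zs]; case: (boolP (mid x z || mid z x)) => [mxz|nm].
  right; exists x, z.
  have [h1 h2] : k.*2 <= f (v k.*2) /\ k.*2 <= f (v k.*2.+1) by rewrite !f_spine; arith.
  have [h3 h4] : k.*2 <= f x /\ k.*2 <= f z by case/orP: mxz => /andP[/eqP -> /eqP ->].
  by split=> //; exists [::], s.
case: (IH z zs) => [h|[p [q [hp hq [s1 [s2 [h1 h2 h3 h4 h5]]]]]]].
  by left; rewrite /cut_edge xz nm.
right; exists p, q; split=> //; exists (z :: s1), s2; split=> //=; rewrite ?xz ?h5 //.
Qed.

(** [f] changes by at most one along an edge, is at most [k] on [P] and at least [k.*2] at both ends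
    of the middle edge, so a path of length at most [k.*2] between vertices of [P] misses that
    edge. *)
Let keep_far x y : x \in P -> y \in P -> y \in gball e k.*2 x -> y \in gball cut_edge k.*2 x.
Proof.
rewrite !inE => xP yP /gballP[s [xs sy sk]]; apply/gballP.
case: (cut_path xs) => [h|[p [q [hp hq [s1 [s2 [h1 h2 h3 h4 h5]]]]]]]; first by exists s.
have [+ _] := f_path h3; have [_ +] := f_path h1.
by rewrite h2 h4 sy; arith.
Qed.

Let par_edge x : M x -> e x (par x).
Proof.
move=> Mx; rewrite /par; case: posnP => [dx|dx]; last by have [] := par0P Mx dx.
have /andP[i1 i2] := idx_itv Mx; rewrite {1}(dep0 Mx dx) es.
by have := spine_edge (j := (idx x).-1); rewrite prednK //; apply; arith.
Qed.

Let iter_dep l x : M x -> l <= dep x ->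
  let w := iter l par x in [/\ M w, idx w = idx x & dep w = dep x - l].
Proof.
move=> Mx; elim: l => [|l IH] ld /=; first by rewrite subn0.
have [h1 h2 h3] := IH (ltnW ld); set w := iter l par x in h1 h2 h3 *.
have dw : 0 < dep w by rewrite h3 subn_gt0.
by rewrite /par dw; have [_ h4 h5 h6] := par0P h1 dw; split=> //; arith.
Qed.

Let iter_spine l j : l <= j -> j < ell -> iter l par (v j) = v (j - l).
Proof.
elim: l => [|l IH] lj jl; first by rewrite subn0.
rewrite iterS IH ?(ltnW lj) //; have [||h1 h2 h3] := spine_in (j := j - l); try arith.
by rewrite /par h3 /= h2 subnS.
Qed.

Let iter_deep l x : M x -> dep x <= l -> l <= idx x + dep x ->
  iter l par x = v (idx x - (l - dep x)).
Proof.
move=> Mx dl ld; rewrite -{1}(subnK dl) iterD.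
have [h1 h2 h3] := iter_dep Mx (leqnn _); rewrite subnn in h3.
by rewrite (dep0 h1 h3) h2 iter_spine //; have := idx_itv Mx; arith.
Qed.

Let iter_in l x : M x -> l < idx x + dep x -> M (iter l par x).
Proof.
move=> Mx ld; have [h|h] := leqP l (dep x); first by have [] := iter_dep Mx h.
rewrite iter_deep //; try arith.
by have [] := spine_in (j := idx x - (l - dep x)); have := idx_itv Mx; try arith.
Qed.

Let branch_off w z s : M w -> M z -> idx z = idx w -> dep z = (dep w).+1 -> par0 z = w ->
  path e z s -> uniq (w :: z :: s) ->
  [/\ M (last z s), idx (last z s) = idx w & dep (last z s) = dep w + (size s).+1].
Proof.
move=> Mw Mz iz dz pz zs /andP[nw uz].
pose Q y := [&& M y, 0 < dep y & idx y == idx w].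
have [|||/and3P[h1 _ /eqP h3] h4] := @descend _ e Q par dep _ s z _ zs uz _.
- move=> x y /and3P[Mx dx /eqP ix] xy.
  case: (nbr Mx xy) => [[_ -> _ _ _]|[My py iy dy]|[dx' _]]; last by rewrite dx' in dx.
    by left; rewrite /par dx.
  by right; rewrite /Q /par My dy iy ix eqxx py.
- by rewrite /Q Mz dz iz eqxx.
- move=> x s' sE; rewrite /par dz /= pz; apply: contraNneq nw => <-.
  by rewrite sE !inE eqxx !orbT.
by split=> //; rewrite h4 dz addnS.
Qed.

(** A path that starts forward on the spine either turns into a tree before [v J], and then every
    step raises [idx + dep], which the last hypothesis excludes, or it follows the spine up to
    [v J]. *)
Let spine_ahead i J s : 0 < i -> i < J -> J <= ell -> path e (v i) s -> uniq (v i :: s) ->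
  (forall z s', s = z :: s' -> z != v i.-1) ->
  ~ [/\ M (last (v i) s), idx (last (v i) s) < J &
        idx (last (v i) s) + dep (last (v i) s) = i + size s] ->
  last (v i) s \in ahead e (size s - (J - i)) (v J.-1) (v J).
Proof.
elim: s i => [|z s IH] i i0 iJ Jl /=.
  move=> _ _ _ no; case: no; have [|h1 h2 h3] := spine_in (j := i) i0; first exact: leq_trans iJ Jl.
  by rewrite h1 h2 h3 addn0.
move=> /andP[iz zs] uz turn no.
have il : i < ell by exact: leq_trans iJ Jl.
have [h1 h2 h3] := spine_in i0 il.
case: (nbr h1 iz) => [[]|[Mz pz iz' dz]|[_]]; first by rewrite h3.
  have [b1 b2 b3] := branch_off h1 Mz iz' dz pz zs uz.
  by case: no; rewrite b2 b3 h2 h3.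
rewrite h2 => -[zE|zE]; first by have := turn _ _ erefl; rewrite zE eqxx.
have uz' : uniq (z :: s) by case/andP: uz.
have [JE|JE] := eqVneq J i.+1.
  rewrite JE /= -zE; have -> : (size s).+1 - (i.+1 - i) = size s by arith.
  by apply: path_ahead.
have sE : (size s).+1 - (J - i) = size s - (J - i.+1) by arith.
have iE : i + (size s).+1 = i.+1 + size s by rewrite addSnnS.
rewrite zE in zs uz uz' no *; rewrite iE in no; rewrite sE.
apply: IH => //; first by rewrite ltn_neqAle eq_sym JE.
by move=> w s' wE /=; apply: contraTneq uz => <-; rewrite wE /= !inE eqxx !orbT.
Qed.

Section Conflicts.
Variable x : T.
Hypothesis fx : k < f x.
Let j := idx x.
Let h := dep x.
Let u := iter k par x.
Let early y := (y \in P) || (key y <= key x).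

Let Mx : M x.
Proof. by move: fx; rewrite /f; case: (M x). Qed.

Let fxE : [/\ k < j + h, k < ell - j + h, 0 < j & j < ell].
Proof. by move: fx (idx_itv Mx); rewrite /f Mx /j /h => h1 /andP[h2 h3]; split; arith. Qed.

Let early_lev y : M y -> early y ->
  [\/ idx y + dep y < j + h, idx y + dep y = j + h /\ j <= idx y | ell - idx y + dep y <= k].
Proof.
move=> My; have /andP[_ il] := idx_itv My; have [fx1 fx2 j0 jl] := fxE.
case/orP => [|ky]; rewrite ?inE.
  rewrite /f My => fy; have [h1|h1|h1] := ltngtP (idx y + dep y) (j + h).
  - by apply: Or31.
  - by apply: Or33; arith.
  - by apply: Or33; arith.
have [h1|h1|h1] := ltngtP (idx y + dep y) (j + h); first by apply: Or31.
  have : (j + h).+1 * ell.+1 <= (idx y + dep y) * ell.+1 by rewrite leq_mul2r h1 orbT.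
  by move: ky; rewrite /key -/j -/h mulSn; arith.
by apply: Or32; split=> //; move: ky; rewrite /key h1 -/j -/h; arith.
Qed.

(** If a path of [n] steps from [v j] leaves the spine at index [i], its end has height
    [n - (i - j)]. It is precoloured from the far end when [ell - i + (n - (i - j)) <= k], that is,
    [2 * (i - j) >= ell - j + n - k]; [J n] is the least such index. *)
Let J n := j + uphalf (ell - j + n - k).

(** A path leaving the ancestor line after [l] steps and continuing for at most [l] more stays in
    the ball. A longer continuation raises the level above that of [x], so an early [y] is at the
    far end or beyond it, and the path must run forward from the foot [v j], with [l = h]. *)
Let conflict_ball y : y \in gball e k.*2 x -> early y -> y \in gball e k u \/
  h < k /\ exists n, [/\ h < n, n <= k.*2 - h & y \in ahead e (n - (J n - j)) (v (J n).-1) (v (J n))].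
Proof.
move=> /gball_uniqP[s [xs us sy sk]] ey; have [fx1 fx2 j0 jl] := fxE.
have [[s' [h1 h2 h3]]|[l [lk ls [ws uw] wy turn]]] := @climb _ e par k x s xs us.
  by left; apply/gballP; exists s'; rewrite h2 -sy; split=> //; arith.
set w := iter l par x in ws uw wy turn.
have Mw : M w by apply: iter_in => //; rewrite -/j -/h; arith.
have uE : u = iter (k - l) par w by rewrite /w -iterD subnK // ltnW.
have short : size (drop l s) <= l -> y \in gball e k u.
  move=> sl; rewrite -(subnK (ltnW lk)); apply: (gball_trans (y := w)).
    rewrite gball_sym // uE; apply: iter_ball => i ik; right.
    by rewrite -iterD; apply/par_edge/iter_in => //; rewrite -/j -/h; arith.
  by apply/gballP; exists (drop l s); rewrite wy.
have sl2 : size (drop l s) <= k.*2 - l by rewrite size_drop; arith.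
have [|long] := leqP (size (drop l s)) l; first by move/short; left.
case E : (drop l s) => [|z s3]; first by rewrite E in long.
have [zw turn'] := turn z s3 E.
move: (ws) (uw); rewrite E => /= /andP[wz zs3] uz.
have yE : y = last z s3 by rewrite -sy -wy E.
have wd : [/\ idx w <= j, h <= dep w + l & idx w + dep w + l = j + h].
  have [hl|hl] := leqP l h.
    by have [_ -> ->] := iter_dep Mx hl; rewrite -/j -/h; split; arith.
  rewrite /w iter_deep -/j -/h //; try arith.
  have [||_ -> ->] := spine_in (j := j - (l - h)); [arith|arith|split; arith].
case: wd => wj wh wl.
case: (nbr Mw wz) => [[dw zE _ _ _]|[Mz pz iz dz]|[dw [zE|zE]]].
- by rewrite /par dw zE eqxx in zw.
- have [b1 b2 b3] := branch_off Mw Mz iz dz pz zs3 uz.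
  rewrite -yE in b1 b2 b3.
  have sE : size (drop l s) = (size s3).+1 by rewrite E.
  by case: (early_lev b1 ey) => [q|[q _]|q]; rewrite b2 b3 in q; arith.
- by rewrite /par dw zE eqxx in zw.
have lh : l = h.
  apply/eqP; rewrite eqn_leq; apply/andP; split; last by arith.
  rewrite leqNgt; apply/negP => hl; have /turn' : 0 < l by arith.
  rewrite zE iter_deep -/j -/h; [|by []|arith|arith].
  by have -> : (idx w).+1 = j - (l.-1 - h); [arith | rewrite eqxx].
right; split; first by rewrite -lh.
have wE : w = v j by rewrite (dep0 Mw dw); congr v; arith.
exists (size (drop l s)); rewrite -lh; split=> //.
have -> : y = last (v j) (drop l s) by rewrite -wE wy.
have nh : h < size (drop l s) by rewrite -lh.
have n2 : size (drop l s) <= k.*2 - h by rewrite -lh.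
set n := size (drop l s) in nh n2 *.
have [J1 J2] : j < J n /\ J n <= ell by rewrite /J; arith.
apply: spine_ahead => //.
- by rewrite -wE.
- by rewrite -wE.
- move=> z' s' E'; have [+ _] := turn z' s' E'.
  by rewrite /par dw /= wE; have [_ -> _] := spine_in j0 jl.
rewrite -wE wy sy => -[My iyJ lv]; rewrite -/n in lv.
case: (early_lev My ey) => [q|[q _]|q]; [arith|arith|].
by move: iyJ; rewrite /J; arith.
Qed.

(* The vertices coloured before [x] near it lie in the ball around its [k]-th
   ancestor [u], minus the part of the outermost level that is coloured later;
   the precoloured vertices on the far side of the thread lie in [far_side]. *)
Let near_side := gball e k.-1 u :|: ahead e k.-1 (v (j + h - k)) (v (j + h - k).-1) :|:
  ahead e h (v j.-1) (v j).

(** A path of full length [k] from [u] either starts backwards or gains a level at each step; in the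
    second case it ends on the level of [x], where only indices at least [j] are early, so it passes
    through [v j]. *)
Let conflict_near y : h < k -> y \in gball e k u -> early y -> y \in near_side.
Proof.
move=> hk /gball_uniqP[s [us uq sy sk]] ey; have [fx1 fx2 j0 jl] := fxE.
have uE : u = v (j + h - k).
  by rewrite /u iter_deep -/j -/h; [congr v; arith|by []|arith|arith].
set i := j + h - k in uE *; have i0 : 0 < i by rewrite /i; arith.
have il : i < ell by rewrite /i; arith.
rewrite /near_side -/i !inE.
have [sk'|sk'] := ltnP (size s) k.
  apply/orP; left; apply/orP; left; apply/gballP; exists s; split=> //.
  by rewrite -ltnS prednK.
have sE : size s = k by apply/eqP; rewrite eqn_leq sk sk'.
have [turn|] := boolP (all (fun z => z != v i.-1) (take 1 s)).
  apply/orP; right; rewrite -sy uE.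
  have -> : h = size s - (j - i) by rewrite sE /i; arith.
  apply: spine_ahead => //; try by rewrite -uE.
  - by rewrite /i; arith.
  - exact: ltnW.
  - by move=> z s' E; move: turn; rewrite E /= => /andP[].
  rewrite -uE sy sE => -[My iyj lv].
  by case: (early_lev My ey) => [q|[q1 q2]|q]; rewrite /i in lv; arith.
case: s us uq sy sk sk' sE => [|z s] //= /andP[uz zs] uq sy sk sk' sE.
rewrite take0 /= andbT negbK => /eqP zE; apply/orP; left; apply/orP; right.
have -> : k.-1 = size s by rewrite -sE.
rewrite -sy -zE -uE; apply: path_ahead => //.
Qed.

Let far_side := \bigcup_(p < (k - h).*2) ahead e (h.+1 + p - (J (h.+1 + p) - j))
  (v (J (h.+1 + p)).-1) (v (J (h.+1 + p))).

Lemma few_conflicts :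
  #|[set y | [&& y != x, y \in gball e k.*2 x & (y \in P) || (key y <= key x)]]| < ball_size a k.
Proof.
have [fx1 fx2 j0 jl] := fxE.
set Cf := [set y | _].
have xu : x \in gball e k u.
  rewrite gball_sym //; apply: iter_ball => i ik; right.
  by apply/par_edge/iter_in => //; rewrite -/j -/h; arith.
have ex : early x by rewrite /early leqnn orbT.
have xCf : x \notin Cf by rewrite !inE eqxx.
have CfE y : y \in Cf -> y \in gball e k.*2 x /\ early y.
  by rewrite !inE => /and3P[_ yb ey]; split=> //; rewrite /early inE.
(* When [k <= h], a path climbs all [k] steps to [u] or turns inside the tree of [x], so the ball
   alone covers the conflicts. *)
have [hk|kh] := ltnP h k; last first.
  apply: leq_trans (card_ball es deg_le k u).
  apply: proper_card; apply/properP; split; last by exists x.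
  apply/subsetP => y /CfE[yb ey].
  by case: (conflict_ball yb ey) => // -[]; rewrite ltnNge kh.
(* Counting [x] along with its conflicts yields the strict inequality. *)
have sub : x |: Cf \subset near_side :|: far_side.
  apply/subsetP => y; rewrite in_setU1 => /orP[/eqP ->|].
    by rewrite inE conflict_near.
  move=> /CfE[yb ey]; rewrite inE.
  have [yu|[_ [n [n1 n2 yn]]]] := conflict_ball yb ey.
    by rewrite (conflict_near hk yu ey).
  apply/orP; right; apply/bigcupP.
  have pn : n - h.+1 < (k - h).*2 by arith.
  by exists (Ordinal pn) => //=; have -> : h.+1 + (n - h.+1) = n by arith.
have := subset_leq_card sub; rewrite cardsU1 xCf add1n => /leq_trans; apply.
apply: leq_trans (leq_card_setU _ _) _.
have near_le : #|near_side| <= ball_size a k.-1 + a ^ k.-1 + a ^ h.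
  apply: leq_trans (leq_card_setU _ _) (leq_add _ _).
    apply: leq_trans (leq_card_setU _ _) (leq_add _ _); first exact: card_ball.
    apply: card_ahead => //; rewrite es.
    have i0 : 0 < j + h - k by arith.
    by have := spine_edge (j := (j + h - k).-1); rewrite prednK //; apply; arith.
  apply: card_ahead => //.
  by have := spine_edge (j := j.-1); rewrite prednK //; apply; arith.
(* For [n = h.+1 + p], the bound [k < ell - j + h] gives [J n - j >= uphalf p.+2], so the exponent
   is at most [h + p./2], and each value of [p./2] occurs twice. *)
have far_le : #|far_side| <= 2 * \sum_(i < k - h) a ^ (h + i).
  apply: (@leq_trans (\sum_(p < (k - h).*2) a ^ (h + p./2))).
    apply: leq_trans (card_bigcup_le _ _) _; apply: leq_sum => -[p pk] _ /=.
    set n := h.+1 + p; apply: (@leq_trans (a ^ (n - (J n - j)))).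
      have [J1 J2] : 0 < J n /\ J n <= ell by rewrite /J /n; arith.
      apply: card_ahead => //.
      by have := spine_edge (j := (J n).-1); rewrite prednK //; apply; arith.
    by rewrite leq_exp2l ?(ltn_trans _ a3) // /J /n; arith.
  elim: (k - h) => [|m IH]; first by rewrite !big_ord0.
  rewrite doubleS !big_ord_recr /= mulnDr -addnA; apply: leq_add => //.
  by rewrite uphalf_double doubleK mul2n addnn.
have := geometric_bound h (k - h) a3; rewrite subnKC ?(ltnW hk) // => geo.
have -> : ball_size a k = ball_size a k.-1 + a.+1 * a ^ k.-1.
  by rewrite -ball_sizeS prednK.
have akE : a ^ k = a * a ^ k.-1 by rewrite -expnS prednK.
apply: leq_trans (leq_add near_le far_le) _.
by rewrite -!addnA (leq_add2l (ball_size a k.-1)) [a.+1 * _]mulSn -akE leq_add2l.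
Qed.

End Conflicts.

Lemma thread_colouring (c0 : T -> nat) : (forall x, c0 x < ball_size a k) ->
  (forall x y, x != y -> y \in gball cut_edge k.*2 x -> c0 x != c0 y) ->
  ball_colourable e k.*2 (ball_size a k).
Proof.
move=> c0n c0P.
apply: (@greedy_colouring _ (fun x y => y \in gball e k.*2 x) P key _ c0) => //.
- by move=> x y; rewrite gball_sym.
- by move=> x y xP yP xy /(keep_far xP yP); exact: c0P.
- by move=> x; rewrite inE -ltnNge => /few_conflicts.
Qed.

End ThreadColouring.

(** * The theorem *)

Section Subgraph.
Variables (G : sgraph) (r : rel G).
Hypothesis rs : symmetric r.

Let sub_edge (x y : G) := x -- y && r x y.

Let sub_edge_sym : symmetric sub_edge.
Proof. by move=> x y; rewrite /sub_edge sedge_sym rs. Qed.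

Let sub_edge_irrefl : irreflexive sub_edge.
Proof. by move=> x; rewrite /sub_edge sedge_irrefl. Qed.

Definition subgraph : sgraph := SGraph sub_edge_sym sub_edge_irrefl.

Lemma planar_subgraph (R : realType) : planar R G -> planar R subgraph.
Proof.
move=> [pos [E [h1 h2 h3 h4]]]; exists pos, E; split=> //.
- by move=> x y /andP[/h2].
- by move=> x y z /andP[/h3 h _]; exact: h.
- by move=> x y u v /andP[xy _] /andP[uv _]; exact: h4.
Qed.

End Subgraph.

(** The form that survives edge deletion: an upper bound [a.+1] on degrees instead of the exact
    maximum [d], and the girth bound [24 * k], which is [12 * t]. *)
Lemma planar_ball_colourable (R : realType) (G : sgraph) (a k : nat) :
  2 < a -> 0 < k -> planar R G -> (forall x : G, #|[set y | x -- y]| <= a.+1) ->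
  (forall c : seq G, ucycle (@sedge G) c -> 2 < size c -> 24 * k <= size c) ->
  ball_colourable (@sedge G) k.*2 (ball_size a k).
Proof.
move=> a3 k0; have [n] := ubnP #|[set u : G * G | u.1 -- u.2]|.
elim: n G => // n IH G En plG dG gG.
pose C := core (@sedge G).
have [par [dep [rt [coreP hang root]]]] := hanging_trees (@sedge_sym G) (@sedge_irrefl G).
have [C0|C0] := eqVneq C finset.set0.
  have nC x : x \notin C by rewrite C0 inE.
  apply: (@forest_colouring _ _ a (@sedge_sym G) dG par dep).
  - by move=> x; case: (root x (nC x)) => [[]|[]]; [right|left].
  - move=> x y xy; case: (hang x y xy) => [|[]|[]]; first by rewrite negb_and nC.
      by left.
    by right.
  - by move=> x; case: (root x (nC x)) => [[_ [_ ->]]|[_ ->]].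
pose L := 4 * k.
have rC : symmetric (fun x y : G => (x \in C) && (y \in C)) by move=> x y; rewrite andbC.
have ecd : has_dual (fun x y : G => [&& x -- y, x \in C & y \in C]).
  exact: (planar_dual (planar_subgraph rC plG)).
have L0 : 0 < L by rewrite muln_gt0.
have gL : 6 * L <= 24 * k by rewrite mulnA.
have [v [vC ve vinj v2]] := core_thread (@sedge_sym G) (@sedge_irrefl G) gG C0 L0 gL ecd.
pose ell := L.+1.
(* Position of the root on the thread. The default 0 also stands for roots off the thread; [M]
   excludes it. *)
pose idx x : nat := if [pick i : 'I_ell.+1 | v i == rt x] is Some i then i else 0.
have idxE x j : j <= ell -> rt x = v j -> idx x = j.
  move=> jl rx; rewrite /idx; case: pickP => [i /eqP iE|none].
    by apply: vinj => //; [rewrite -ltnS; exact: ltn_ord|rewrite iE].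
  by have := none (Ordinal (jl : j < ell.+1)); rewrite /= rx eqxx.
pose M : pred G := fun x => (0 < idx x < ell) && (rt x == v (idx x)).
have Meq x y : rt x = rt y -> M x -> M y /\ idx y = idx x.
  by move=> rxy; rewrite /M /idx rxy.
have coreM x : M x -> x \in C -> x = v (idx x).
  by move=> /andP[_ /eqP <-] /coreP[_ ->].
pose r x y := ~~ ((x == v k.*2) && (y == v k.*2.+1) || (y == v k.*2) && (x == v k.*2.+1)).
have rs : symmetric r by move=> x y; rewrite /r orbC.
have [||||c [cn cP]] := IH (subgraph rs).
- rewrite -ltnS; apply: leq_trans En; rewrite ltnS.
  apply: proper_card; apply/properP; split.
    by apply/subsetP => u; rewrite !inE => /andP[].
  exists (v k.*2, v k.*2.+1); first by rewrite inE /= ve // /L; lia.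
  by rewrite inE /= /r !eqxx andbF.
- exact: planar_subgraph.
- move=> x; apply: leq_trans (dG x); apply: subset_leq_card; apply/subsetP => y.
  by rewrite !inE => /andP[].
- move=> c /andP[cc uc]; apply: gG; rewrite /ucycle uc andbT.
  by apply: sub_cycle cc => x y /andP[].
apply: (@thread_colouring _ _ a k ell (@sedge_sym G) dG a3 k0 erefl v M idx dep par _ _ _ _ _ _ _ c cn cP).
- move=> j j0 jl; have vj := vC j (ltnW jl); have [d0 rv] := coreP _ vj.
  have ij := idxE (v j) j (ltnW jl) rv.
  by split=> //; rewrite /M ij j0 jl rv eqxx.
- by move=> x /andP[].
- move=> x Mx dx; case: (boolP (x \in C)) => [|nx]; first exact: coreM.
  have /andP[_ /eqP rx] := Mx.
  case: (root x nx) => [[_ [_ h _ _]]|[_ _ rxx]]; first by rewrite h in dx.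
  by rewrite -rx rxx.
- move=> x y Mx xy; case: (boolP ((x \in C) && (y \in C))) => [/andP[xC yC]|nxy].
    have xE := coreM x Mx xC; have /andP[/andP[i0 il] _] := Mx.
    apply: Or33; split; first by have [] := coreP x xC.
    by apply: v2 => //; rewrite -xE.
  case: (hang x y xy nxy) => [[h1 h2 h3 h4]|[h1 h2 h3 h4]].
    by have [My iy] := Meq x y h3 Mx; apply: Or31; split=> //; rewrite h2.
  by have [My iy] := Meq x y (esym h3) Mx; apply: Or32.
- move=> x Mx dx; have nx : x \notin C by apply: contraL dx => /coreP[->].
  case: (root x nx) => [[xp [_ h2 h3 _]]|[_ h _]]; last by rewrite h in dx.
  by have [My iy] := Meq x (par x) h3 Mx.
- have [_ r0] := coreP _ (vC 0 isT); have [_ rl] := coreP _ (vC ell (leqnn _)).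
  by split; rewrite /M ?(idxE _ 0 isT r0) // (idxE _ ell (leqnn _) rl) ltnn andbF.
- exact: ve.
Qed.

Lemma dist_le_ball (G : sgraph) (t : nat) (x y : G) :
  at_most (dist x y) t -> y \in gball (@sedge G) t x.
Proof.
rewrite /dist /least; case: pselect => // ex; case: ex_minnP => m /asboolP[s [s1 _ s3 s4]] _ /= mt.
by apply/gballP; exists s; rewrite s4.
Qed.

Lemma dist_chromatic_le (G : sgraph) (t n : nat) :
  ball_colourable (@sedge G) t n -> dist_chromatic G t <= n.
Proof.
move=> [c [cn cP]]; rewrite /dist_chromatic; case: ex_minnP => m _; apply.
apply/existsP; exists [ffun x => Ordinal (cn x)].
apply/forallP => x; apply/forallP => y; apply/implyP => /andP[xy /dist_le_ball yx].
by rewrite !ffunE -val_eqE /=; exact: cP.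
Qed.

Lemma at_least_girth (G : sgraph) (g : nat) (c : seq G) : at_least (girth G) g ->
  ucycle (@sedge G) c -> 2 < size c -> g <= size c.
Proof.
rewrite /girth /least => + cc c2; case: pselect => [ex|none] /= h; last first.
  by case: none; exists (size c); apply/asboolP; exists c.
apply: leq_trans h _; case: ex_minnP => m _; apply; apply/asboolP; by exists c.
Qed.

Lemma tau_ball_size (k b : nat) : 0 < b -> tau k.*2 b.+2 = ((ball_size b.+1 k)%:R)%R.
Proof.
move=> b0; have E : b * ball_size b.+1 k + 2 = b.+2 * b.+1 ^ k.
  elim: k => [|n IH]; first by rewrite /ball_size big_ord0 muln1; lia.
  by rewrite ball_sizeS mulnDr addnAC IH expnS; nia.
have {}E := congr1 (fun m => (m%:R)%R : rat) E.
rewrite natrD !natrM natrX in E.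
rewrite /tau divn2 doubleK -{1}addn2 natrD addrK -{2}[b.+2]addn1 natrD addrK -E addrK mulKf //.
by rewrite pnatr_eq0 -lt0n.
Qed.

Local Open Scope ring_scope.

Theorem theorem4p3 (R : realType) (G : sgraph) (t d : nat)
    (ht : (2 <= t)%N) (ht_even : ~~ odd t)
    (hplanar : planar R G)
    (hd : (4 <= d)%N) (hdeg : max_degree G = d)
    (hgirth : at_least (girth G) (6 * (t ^ 2 + t - 2))) :
  (dist_chromatic G t)%:R <= tau t d.
Proof.
have tE : t = (t./2).*2 by rewrite even_halfK.
have k0 : (0 < t./2)%N by rewrite half_gt0.
have [b dE] : exists b, d = b.+2 by exists d.-2; case: d hd {hdeg} => [|[]].
rewrite {}dE in hd hdeg *; have b0 : (1 < b)%N by [].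
rewrite tE tau_ball_size; last exact: ltnW.
rewrite ler_nat; apply: dist_chromatic_le; apply: (planar_ball_colourable _ k0 hplanar) => //.
- move=> x; rewrite -hdeg; apply: leq_trans (leq_bigmax x).
  by apply: subset_leq_card; apply/subsetP => y; rewrite !inE.
- move=> c cc c2; apply: leq_trans (at_least_girth hgirth cc c2).
  (* With [t = 2 * k] the girth bound is [24 * k ^ 2 + 12 * k - 12], which is at least [24 * k],
     with equality for [k = 1]. *)
  by rewrite tE; move: (t./2) k0 => k k1; rewrite doubleK; nia.
Qed.
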